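(* Let $A$ be a weak Hopf algebra and $H$ a Hopf algebra over a field $\mathbb{F}$, and let $\pi:A\to H$ be a Hopf map. Then the relative restriction of scalars $\pi^*:\mathrm{Rep}(H)\to\mathrm{Rep}(A)$ is a tensor functor, with unitor $\pi^*(\mathbb{F}_\epsilon)\to A_t$ given by $x\boxtimes 1_{\mathbb{F}_\epsilon}\mapsto x$ and tensorator $\pi^*(M\otimes^H N)\to\pi^*(M)\otimes^A\pi^*(N)$ given by $$x\boxtimes(m\otimes n)\mapsto 1_A^{(1)}(x\boxtimes m)\otimes 1_A^{(2)}(1\boxtimes n)$$ for $x\in A_t$, $m\in M$, $n\in N$, $M,N\in\mathrm{Rep}(H)$.
   Context: Fix a field $\mathbb{F}$. Sweedler notation without summation sign is used: $\Delta(a)=a^{(1)}\otimes a^{(2)}$. A weak Hopf algebra is a unital associative algebra $A$ that is also a coassociative counital coalgebra, with a linear map $S:A\to A$, such that for all $a,b,c\in A$: $\Delta(ab)=\Delta(a)\Delta(b)$; $(\Delta\otimes\mathrm{id})\Delta(1)=(\Delta(1)\otimes 1)(1\otimes\Delta(1))=(1\otimes\Delta(1))(\Delta(1)\otimes 1)$; $\epsilon(abc)=\epsilon(ab^{(1)})\epsilon(b^{(2)}c)=\epsilon(ab^{(2)})\epsilon(b^{(1)}c)$; $a^{(1)}S(a^{(2)})=\epsilon(1^{(1)}a)1^{(2)}$; $S(a^{(1)})a^{(2)}=1^{(1)}\epsilon(a1^{(2)})$; $S(a^{(1)})a^{(2)}S(a^{(3)})=S(a)$. Put $\epsilon_t(a)=a^{(1)}S(a^{(2)})$,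 $\epsilon_s(a)=S(a^{(1)})a^{(2)}$, $A_t=\epsilon_t(A)$, $A_s=\epsilon_s(A)$; these are separable subalgebras. $\mathrm{Rep}(A)$ is the category of finite-dimensional left $A$-modules. It is monoidal with $M\otimes^A N=1_A^{(1)}M\otimes 1_A^{(2)}N=\Delta(1_A)(M\otimes N)$ and action $a\cdot(m\otimes n)=a^{(1)}m\otimes a^{(2)}n$; the unit object is $A_t$ with action $a\cdot x=\epsilon_t(ax)$. $\mathbb{F}_\epsilon$ denotes the trivial one-dimensional $H$-module, with basis element $1_{\mathbb{F}_\epsilon}$. A Hopf map $\pi:A\to H$ is a counital coalgebra homomorphism with $\pi\circ S_A=S_H\circ\pi$ that is birelatively multiplicative: $\pi(aS(1^{(1)}))\pi(1^{(2)}b)=\pi(ab)=\pi(a1^{(1)})\pi(S(1^{(2)})b)$ for all $a,b\in A$. The relative restriction of scalars (relative to $A_t$) is $\pi^*(M)=A_t\otimes M/\mathrm{span}\{x\otimes m-S(1^{(1)})\otimes\pi(1^{(2)}x)m\mid x\in A_t,\ m\in M\}$, with $x\boxtimes m$ the class of $x\otimes m$, action $a\cdot(x\boxtimes m)=S(1^{(1)})\boxtimes\pi(1^{(2)}ax)m$, and $\pi^*(f)(x\boxtimes m)=x\boxtimes f(m)$. A tensor functor is an exact, faithful, $\mathbb{F}$-linear, (strong) monoidal functor. *)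

(* Defs.v *)
From HB Require Import structures.
From mathcomp Require Import all_boot all_order all_algebra.
From mathcomp Require Import boolp.
Set Implicit Arguments.
Unset Strict Implicit.
Unset Printing Implicit Defensive.
Import GRing.Theory.
Local Open Scope ring_scope.
Local Open Scope quotient_scope.

Notation bilin f := (bilinear_for *:%R *:%R f).

Section Bilin.
Variables (F : fieldType) (U V : lmodType F).
Lemma lin0 (f : U -> V) : linear f -> f 0 = 0.
Proof. by move=> lf; have := lf (-1) 0 0; rewrite !scaleN1r !addNr. Qed.
Lemma linZ (f : U -> V) : linear f -> forall c x, f (c *: x) = c *: f x.
Proof. by move=> lf c x; have := lf c x 0; rewrite (lin0 lf) !addr0. Qed.
Lemma linN (f : U -> V) : linear f -> forall x, f (- x) = - f x.
Proof. by move=> lf x; rewrite -scaleN1r (linZ lf) scaleN1r. Qed.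
Lemma linD (f : U -> V) : linear f -> forall x y, f (x + y) = f x + f y.
Proof. by move=> lf x y; have := lf 1 x y; rewrite !scale1r. Qed.
Lemma lin_sum (f : U -> V) I (r : seq I) (g : I -> U) : linear f ->
  f (\sum_(i <- r) g i) = \sum_(i <- r) f (g i).
Proof.
move=> lf; elim: r => [|i r IH]; first by rewrite !big_nil (lin0 lf).
by rewrite !big_cons (linD lf) IH.
Qed.
End Bilin.

(* The tensor product over F: finite formal sums of pairs, two of them being
   identified when every bilinear map gives them the same value. *)
Section Tensor.
Variables (F : fieldType) (U V : lmodType F).
Implicit Types (s t : seq (U * V)).

Definition formal_sum (W : lmodType F) (f : U -> V -> W) s : W :=
  \sum_(p <- s) f p.1 p.2.

Definition tens_eq : rel (seq (U * V)) := fun s t =>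
  `[< forall (W : lmodType F) (f : U -> V -> W), bilin f ->
      formal_sum f s = formal_sum f t >].

Lemma tens_eq_equiv : equiv_class_of tens_eq.
Proof.
split=> [s|s t|t s u]; first exact/asboolP.
  by apply/asboolP/asboolP => st W f bf; rewrite st.
by move=> /asboolP st /asboolP tu; apply/asboolP => W f bf; rewrite st ?tu.
Qed.
Canonical tens_eq_rel := EquivRelPack tens_eq_equiv.

Definition tensor : Type := {eq_quot tens_eq}.
HB.instance Definition _ : EqQuotient _ tens_eq tensor := EqQuotient.on tensor.
HB.instance Definition _ := Choice.on tensor.

Definition tens (x : U) (y : V) : tensor := \pi_tensor [:: (x, y)].

(* The sum of f x y over a chosen decomposition of t into pure tensors x (x) y,
   written \sw_(x, y <- t) f x y in Sweedler fashion.  It is independent of the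
   decomposition, and linear in t, when f is bilinear. *)
Definition tsum (W : lmodType F) (t : tensor) (f : U -> V -> W) : W :=
  formal_sum f (repr t).

Lemma tens_piP s t : (forall (W : lmodType F) (f : U -> V -> W), bilin f ->
      formal_sum f s = formal_sum f t) <-> \pi_tensor s = \pi_tensor t.
Proof. by split=> [st|/eqmodP/asboolP//]; apply/eqmodP/asboolP. Qed.

Lemma tsum_pi (W : lmodType F) (f : U -> V -> W) s : bilin f ->
  tsum (\pi_tensor s) f = formal_sum f s.
Proof. by move=> bf; have/tens_piP e := reprK (\pi_tensor s); apply: e. Qed.

Let opp_ s := [seq (- p.1, p.2) | p <- s].
Let scale_ (c : F) s := [seq (c *: p.1, p.2) | p <- s].

Let sum_cat (W : lmodType F) (f : U -> V -> W) s t :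
  formal_sum f (s ++ t) = formal_sum f s + formal_sum f t.
Proof. by rewrite /formal_sum big_cat. Qed.

Let sum_opp (W : lmodType F) (f : U -> V -> W) s : bilin f ->
  formal_sum f (opp_ s) = - formal_sum f s.
Proof.
move=> [bf _]; rewrite /formal_sum big_map -sumrN; apply: eq_bigr => p _ /=.
by rewrite (linN (bf _)).
Qed.

Let sum_scale (W : lmodType F) (f : U -> V -> W) c s : bilin f ->
  formal_sum f (scale_ c s) = c *: formal_sum f s.
Proof.
move=> [bf _]; rewrite /formal_sum big_map scaler_sumr; apply: eq_bigr => p _ /=.
by rewrite (linZ (bf _)).
Qed.

Let repr_pi (W : lmodType F) (f : U -> V -> W) s : bilin f ->
  formal_sum f (repr (\pi_tensor s)) = formal_sum f s.
Proof. exact: tsum_pi. Qed.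

Let add (s t : tensor) : tensor := \pi_tensor (repr s ++ repr t).
Let opp (s : tensor) : tensor := \pi_tensor (opp_ (repr s)).
Let zero : tensor := \pi_tensor [::].
Let scale c (s : tensor) : tensor := \pi_tensor (scale_ c (repr s)).

Let addA : associative add.
Proof.
by move=> x y z; apply/tens_piP => W f bf; rewrite !sum_cat !repr_pi // !sum_cat addrA.
Qed.
Let addC : commutative add.
Proof. by move=> x y; apply/tens_piP => W f bf; rewrite !sum_cat addrC. Qed.
Let add0 : left_id zero add.
Proof.
move=> x; rewrite -[RHS]reprK; apply/tens_piP => W f bf.
by rewrite sum_cat repr_pi // /formal_sum big_nil add0r.
Qed.
Let addN : left_inverse zero opp add.
Proof.
move=> x; apply/tens_piP => W f bf.
by rewrite sum_cat repr_pi // sum_opp // addNr /formal_sum big_nil.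
Qed.
HB.instance Definition _ := GRing.isZmodule.Build tensor addA addC add0 addN.

Let scaleA a b v : scale a (scale b v) = scale (a * b) v.
Proof.
by apply/tens_piP => W f bf; rewrite !sum_scale // repr_pi // sum_scale // scalerA.
Qed.
Let scale1 : left_id 1 scale.
Proof.
move=> x; rewrite -[RHS]reprK; apply/tens_piP => W f bf.
by rewrite sum_scale // scale1r.
Qed.
Let scaleDr : right_distributive scale +%R.
Proof.
move=> a x y; apply/tens_piP => W f bf.
by rewrite !sum_cat !sum_scale // !repr_pi // sum_cat !sum_scale // scalerDr.
Qed.
Let scaleDl v : {morph scale^~ v : a b / a + b}.
Proof.
move=> a b; apply/tens_piP => W f bf.
by rewrite !sum_cat !sum_scale // !repr_pi // !sum_scale // scalerDl.
Qed.
HB.instance Definition _ :=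
  GRing.Zmodule_isLmodule.Build F tensor scaleA scale1 scaleDr scaleDl.

Lemma tsum_linear (W : lmodType F) (f : U -> V -> W) : bilin f ->
  linear (fun t : tensor => tsum t f).
Proof.
move=> bf a s t.
by rewrite /tsum repr_pi // sum_cat repr_pi // sum_scale.
Qed.

Lemma tsum_tens (W : lmodType F) (f : U -> V -> W) x y : bilin f ->
  tsum (tens x y) f = f x y.
Proof. by move=> bf; rewrite tsum_pi // /formal_sum big_seq1. Qed.

Lemma tens_bilin : bilin tens.
Proof.
split=> [y|x] c u v /=; apply/tens_piP => W f bf;
  rewrite sum_cat !repr_pi // sum_scale // repr_pi // /formal_sum !big_seq1 /=.
  exact: bf.1.
exact: bf.2.
Qed.

Lemma tsum_id (t : tensor) : tsum t tens = t.
Proof.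
rewrite -[RHS]reprK; set s := repr t; rewrite /tsum -/s.
elim: s => [|p s IH]; first by rewrite /formal_sum big_nil.
rewrite /formal_sum big_cons -/(formal_sum tens s) IH.
apply/tens_piP => W f bf; rewrite sum_cat !repr_pi //.
by rewrite /formal_sum big_seq1 big_cons.
Qed.

Lemma tens_ext (W : lmodType F) (f g : tensor -> W) : linear f -> linear g ->
  (forall x y, f (tens x y) = g (tens x y)) -> f =1 g.
Proof.
move=> lf lg fg t; rewrite -(tsum_id t) /tsum /formal_sum !lin_sum //.
by apply: eq_bigr.
Qed.

Lemma lin_tsum (W X : lmodType F) (g : W -> X) (t : tensor) (f : U -> V -> W) : linear g ->
  g (tsum t f) = tsum t (fun x y => g (f x y)).
Proof. by move=> lg; rewrite /tsum /formal_sum lin_sum. Qed.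

Lemma eq_tsum (W : lmodType F) (f g : U -> V -> W) (t : tensor) :
  (forall x y, f x y = g x y) -> tsum t f = tsum t g.
Proof. by move=> fg; apply: eq_bigr => p _; apply: fg. Qed.

Lemma tsum_linear_r (W X : lmodType F) (f : X -> U -> V -> W) (t : tensor) :
  (forall x y, linear (fun z => f z x y)) -> linear (fun z => tsum t (f z)).
Proof.
move=> lf a z z'; rewrite /tsum /formal_sum scaler_sumr -big_split /=.
by apply: eq_bigr => p _; apply: lf.
Qed.

End Tensor.

Notation "\sw_ ( x , y <- t ) E" := (tsum t (fun x y => E))
  (at level 36, E at level 36, x name, y name, format "\sw_ ( x ,  y  <-  t )  E").

Section TensorMap.
Variables (F : fieldType).
Variables (U V U' V' : lmodType F).

Lemma lin_tsumt (X W : lmodType F) (t : X -> tensor U V) (f : U -> V -> W) :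
  linear t -> bilin f -> linear (fun z => tsum (t z) f).
Proof. by move=> lt bf a x y; rewrite lt; apply: tsum_linear. Qed.
Lemma lin_tensl (X : lmodType F) (f : X -> U) y : linear f ->
  linear (fun z => tens (f z) y : tensor U V).
Proof. by move=> lf a x z; rewrite lf; apply: (tens_bilin U V).1. Qed.
Lemma lin_tensr (X : lmodType F) (f : X -> V) y : linear f ->
  linear (fun z => tens y (f z) : tensor U V).
Proof. by move=> lf a x z; rewrite lf; apply: (tens_bilin U V).2. Qed.
Lemma lin_app (X : lmodType F) (g : {linear U -> V}) (f : X -> U) : linear f ->
  linear (fun z => g (f z)).
Proof. by move=> lf a x z; rewrite lf linearP. Qed.
Lemma lin_scalel (X : lmodType F) (f : X -> F^o) (v : U) : linear f ->
  linear (fun z => (f z : F) *: v).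
Proof. by move=> lf a x z; rewrite lf scalerDl scalerA. Qed.
Lemma lin_scaler (X : lmodType F) (f : X -> U) (a : F) : linear f ->
  linear (fun z => a *: f z).
Proof. by move=> lf b x z; rewrite lf scalerDr !scalerA mulrC. Qed.
Lemma lin_mull (A : algType F) (X : lmodType F) (f : X -> A) (a : A) : linear f ->
  linear (fun z => f z * a).
Proof. by move=> lf b x z; rewrite lf mulrDl scalerAl. Qed.
Lemma lin_mulr (A : algType F) (X : lmodType F) (f : X -> A) (a : A) : linear f ->
  linear (fun z => a * f z).
Proof. by move=> lf b x z; rewrite lf mulrDr; congr (_ + _); rewrite -scalerAr. Qed.
Lemma lin_fmull (X : lmodType F) (f : X -> F^o) (a : F) : linear f ->
  linear (fun z => (f z * a : F^o)).
Proof. by move=> lf b x z; rewrite lf mulrDl -scalerAl. Qed.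
Lemma lin_fmulr (X : lmodType F) (f : X -> F^o) (a : F) : linear f ->
  linear (fun z => (a * f z : F^o)).
Proof. by move=> lf b x z; rewrite lf mulrDr; congr (_ + _); exact: mulrCA. Qed.
Lemma lin_id : linear (fun z : U => z).
Proof. by []. Qed.
Lemma lin_bil1 (X W : lmodType F) (g : U -> V -> W) (f : X -> U) (v : V) :
  bilin g -> linear f -> linear (fun z => g (f z) v).
Proof. by move=> bg lf b x z; rewrite lf; apply: bg.1. Qed.
Lemma lin_bil2 (X W : lmodType F) (g : U -> V -> W) (f : X -> V) (v : U) :
  bilin g -> linear f -> linear (fun z => g v (f z)).
Proof. by move=> bg lf b x z; rewrite lf; apply: bg.2. Qed.
End TensorMap.

Create HintDb bil.
#[global] Hint Resolve tens_bilin : bil.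

Ltac linp := repeat first
  [ exact: lin_id
  | exact: linearP
  | match goal with |- @GRing.linear_for _ _ _ ?s ?f =>
      lazymatch f with
      | (fun _ => _) => fail
      | _ => change (linear (fun z => f z))
      end
    end
  | assumption
  | solve [auto with bil nocore]
  | progress (cbv beta)
  | match goal with
    | |- (_ * _)%type => split; intro
    | |- @bilinear_for _ _ _ _ _ _ _ => split; intro
    | |- @GRing.linear_for _ _ _ _ (fun z => @tsum _ _ _ _ ?t (@?f z)) =>
      apply: tsum_linear_r; intros ? ?
    | |- @GRing.linear_for _ _ _ _ (fun z => @tsum _ _ _ _ (@?t z) ?f) => apply: lin_tsumt
    | |- @GRing.linear_for _ _ _ _ (fun z => @tens _ _ _ (@?f z) ?c) => apply: lin_tensl
    | |- @GRing.linear_for _ _ _ _ (fun z => @tens _ _ _ ?c (@?f z)) => apply: lin_tensr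
    end
  | apply: lin_scalel | apply: lin_scaler
  | apply: lin_mull | apply: lin_mulr
  | apply: lin_fmull | apply: lin_fmulr
  | apply: lin_app
  | apply: lin_bil1; [solve [auto with bil nocore] |]
  | apply: lin_bil2; [solve [auto with bil nocore] |] ].

Section TMap.
Variable F : fieldType.

Section Def.
Variables (U V U' V' : lmodType F) (f : {linear U -> U'}) (g : {linear V -> V'}).
Definition tmap (t : tensor U V) : tensor U' V' := \sw_(x, y <- t) tens (f x) (g y).
Lemma tmap_linear : linear tmap. Proof. rewrite /tmap; linp. Qed.
HB.instance Definition _ :=
  GRing.isLinear.Build F (tensor U V) (tensor U' V') _ tmap tmap_linear.
Lemma tmap_tens x y : tmap (tens x y) = tens (f x) (g y).
Proof. by rewrite /tmap tsum_tens; linp. Qed.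
End Def.

Section Assoc.
Variables (U V W : lmodType F).
Definition tassoc (t : tensor (tensor U V) W) : tensor U (tensor V W) :=
  \sw_(p, w <- t) \sw_(u, v <- p) tens u (tens v w).
Lemma tassoc_linear : linear tassoc. Proof. rewrite /tassoc; linp. Qed.
HB.instance Definition _ := GRing.isLinear.Build F _ _ _ tassoc tassoc_linear.
Lemma tassoc_tens x y z : tassoc (tens (tens x y) z) = tens x (tens y z).
Proof. by rewrite /tassoc !tsum_tens; linp. Qed.
End Assoc.

End TMap.

Section Image.
Variables (F : fieldType) (U V : lmodType F) (f : {linear U -> V}).

Definition im_pred : {pred V} := fun v => `[< exists u, v = f u >].

Fact im_closed : submod_closed im_pred.
Proof.
split=> [|c _ _ /asboolP[u ->] /asboolP[v ->]]; apply/asboolP.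
  by exists 0; rewrite linear0.
by exists (c *: u + v); rewrite linearP.
Qed.
HB.instance Definition _ := GRing.isSubmodClosed.Build F V im_pred im_closed.

Record limage := LImage { limval :> V; _ : limval \in im_pred }.
HB.instance Definition _ := [isSub for limval].
HB.instance Definition _ := [Choice of limage by <:].
HB.instance Definition _ := [SubChoice_isSubLmodule of limage by <:].

Fact limval_linear : linear limval. Proof. by []. Qed.
HB.instance Definition _ :=
  GRing.isLinear.Build F limage V _ limval limval_linear.

Fact toim_subproof u : f u \in im_pred. Proof. by apply/asboolP; exists u. Qed.
Definition toim (u : U) : limage := LImage (toim_subproof u).
Fact toim_linear : linear toim.
Proof. by move=> c u v; apply: val_inj; rewrite /= linearP. Qed.
HB.instance Definition _ := GRing.isLinear.Build F U limage _ toim toim_linear.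

Lemma toim_surj (v : limage) : exists u, v = toim u.
Proof.
by case: v => v vP; have /asboolP[u vE] := vP; exists u; apply: val_inj.
Qed.
End Image.

Section Quotient.
Variables (F : fieldType) (V : lmodType F) (G : V -> Prop).

Definition span (v : V) : Prop :=
  exists2 s : seq (F * V), (forall p, p \in s -> G p.2)
                         & v = \sum_(p <- s) p.1 *: p.2.

Definition span_eq : rel V := fun x y => `[< span (x - y) >].

Lemma span0 : span 0.
Proof. by exists [::]; rewrite ?big_nil. Qed.
Lemma spanD x y : span x -> span y -> span (x + y).
Proof.
move=> [s sG ->] [t tG ->]; exists (s ++ t); last by rewrite big_cat.
by move=> p; rewrite mem_cat => /orP[/sG|/tG].
Qed.
Lemma spanZ c x : span x -> span (c *: x).
Proof.
move=> [s sG ->]; exists [seq (c * p.1, p.2) | p <- s].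
  by move=> p /mapP[q /sG Gq ->].
by rewrite big_map scaler_sumr; apply: eq_bigr => p _; rewrite scalerA.
Qed.
Lemma spanN x : span x -> span (- x).
Proof. by rewrite -scaleN1r; apply: spanZ. Qed.
Lemma span_gen x : G x -> span x.
Proof.
move=> Gx; exists [:: (1, x)]; last by rewrite big_seq1 scale1r.
by move=> p; rewrite inE => /eqP ->.
Qed.

Lemma span_eq_equiv : equiv_class_of span_eq.
Proof.
have refl : reflexive span_eq by move=> x; apply/asboolP; rewrite subrr; apply: span0.
have sym x y : span_eq x y -> span_eq y x.
  by move=> /asboolP/spanN; rewrite opprB => h; apply/asboolP.
split=> // [x y|y x z]; first by apply/idP/idP; apply: sym.
move=> /asboolP xy /asboolP yz; apply/asboolP.
by rewrite -(subrK y x) -addrA; apply: spanD.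
Qed.
Canonical span_eq_rel := EquivRelPack span_eq_equiv.

Definition lquot : Type := {eq_quot span_eq}.
HB.instance Definition _ : EqQuotient _ span_eq lquot := EqQuotient.on lquot.
HB.instance Definition _ := Choice.on lquot.

Definition lclass (v : V) : lquot := \pi_lquot v.

Lemma lclassP x y : lclass x = lclass y <-> span (x - y).
Proof. by split=> [/eqmodP/asboolP//|h]; apply/eqmodP/asboolP. Qed.

Let rK (x : V) : span (repr (lclass x) - x).
Proof. by apply/lclassP; rewrite /lclass reprK. Qed.

Let add (x y : lquot) : lquot := lclass (repr x + repr y).
Let opp (x : lquot) : lquot := lclass (- repr x).
Let scale c (x : lquot) : lquot := lclass (c *: repr x).

Let addE x y : add (lclass x) (lclass y) = lclass (x + y).
Proof. by apply/lclassP; rewrite opprD addrACA; apply: spanD. Qed.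
Let oppE x : opp (lclass x) = lclass (- x).
Proof. by apply/lclassP; rewrite -opprD; apply/spanN/rK. Qed.
Let scaleE c x : scale c (lclass x) = lclass (c *: x).
Proof. by apply/lclassP; rewrite -scalerBr; apply/spanZ/rK. Qed.
Lemma lclass_surj (x : lquot) : exists v, x = lclass v.
Proof. by exists (repr x); rewrite /lclass reprK. Qed.

Let addA : associative add.
Proof.
move=> x y z; have [[u ->] [v ->] [w ->]] :=
  And3 (lclass_surj x) (lclass_surj y) (lclass_surj z).
by rewrite !addE addrA.
Qed.
Let addC : commutative add.
Proof. by move=> x y; rewrite /add addrC. Qed.
Let add0 : left_id (lclass 0) add.
Proof. by move=> x; have [u ->] := lclass_surj x; rewrite addE add0r. Qed.
Let addN : left_inverse (lclass 0) opp add.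
Proof. by move=> x; have [u ->] := lclass_surj x; rewrite oppE addE addNr. Qed.
HB.instance Definition _ := GRing.isZmodule.Build lquot addA addC add0 addN.

Let scaleA a b v : scale a (scale b v) = scale (a * b) v.
Proof. by have [u ->] := lclass_surj v; rewrite !scaleE scalerA. Qed.
Let scale1 : left_id 1 scale.
Proof. by move=> v; have [u ->] := lclass_surj v; rewrite scaleE scale1r. Qed.
Let scaleDr : right_distributive scale +%R.
Proof.
move=> a x y; have [u ->] := lclass_surj x; have [v ->] := lclass_surj y.
have -> : lclass u + lclass v = lclass (u + v) by apply: addE.
rewrite !scaleE scalerDr; symmetry; exact: addE.
Qed.
Let scaleDl v : {morph scale^~ v : a b / a + b}.
Proof.
move=> a b; have [u ->] := lclass_surj v.
rewrite !scaleE scalerDl; symmetry; exact: addE.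
Qed.
HB.instance Definition _ :=
  GRing.Zmodule_isLmodule.Build F lquot scaleA scale1 scaleDr scaleDl.

Fact lclass_linear : linear lclass.
Proof.
by move=> c x y; rewrite -addE -scaleE.
Qed.
HB.instance Definition _ := GRing.isLinear.Build F V lquot _ lclass lclass_linear.

Section Lift.
Variables (W : lmodType F) (f : {linear V -> W}).
Definition lqlift (x : lquot) : W := f (repr x).
Hypothesis fG : forall v, G v -> f v = 0.
Lemma lqliftE v : lqlift (lclass v) = f v.
Proof.
rewrite /lqlift; have [s sG] := rK v.
move=> e; apply/eqP; rewrite -subr_eq0 -linearB e linear_sum big_seq.
by apply/eqP/big1 => p /sG Gp; rewrite linearZ /= fG // scaler0.
Qed.
Lemma lqlift_linear : linear lqlift.
Proof.
move=> c x y; have [u ->] := lclass_surj x; have [v ->] := lclass_surj y.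
by rewrite -linearP !lqliftE linearP.
Qed.
End Lift.
End Quotient.

(* A vectType would come with a chosen basis, which the tensor products and
   quotients used below do not have. *)
Section Findim.
Variable F : fieldType.
Definition findim (V : lmodType F) : Prop :=
  exists n (e : 'I_n -> V), forall v, exists c : 'I_n -> F,
    v = \sum_(i < n) c i *: e i.

Lemma findim_fin (V : lmodType F) (I : finType) (e : I -> V) :
  (forall v, exists c : I -> F, v = \sum_i c i *: e i) -> findim V.
Proof.
move=> eP; exists #|I|, (e \o enum_val) => v; have [c ->] := eP v.
exists (c \o enum_val); rewrite (reindex (@enum_val I I)) //=.
by exists enum_rank => i _; [exact: enum_valK|exact: enum_rankK].
Qed.

Lemma findim_surj (U V : lmodType F) (f : U -> V) : linear f ->
  (forall v, exists u, v = f u) -> findim U -> findim V.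
Proof.
move=> lf fs [n [e eP]]; exists n, (f \o e) => v; have [u ->] := fs v.
have [c ->] := eP u; exists c; rewrite lin_sum //.
by apply: eq_bigr => i _; rewrite linZ.
Qed.

Lemma findim_regular : findim F^o.
Proof. by exists 1, (fun=> 1) => v; exists (fun=> v); rewrite big_ord1 [_ *: _]mulr1. Qed.

Lemma findim_tensor (U V : lmodType F) : findim U -> findim V -> findim (tensor U V).
Proof.
move=> [n [e eP]] [m [d dP]].
apply: (@findim_fin _ _ (fun p : 'I_n * 'I_m => tens (e p.1) (d p.2))) => t.
rewrite -(tsum_id t) /tsum /formal_sum.
elim: (repr t) => [|[x y] s [c IH]].
  by exists (fun=> 0); rewrite big_nil big1 // => i _; rewrite scale0r.
have [a xE] := eP x; have [b yE] := dP y.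
exists (fun p => a p.1 * b p.2 + c p).
rewrite big_cons IH [in LHS]/= xE yE.
rewrite (lin_sum _ _ ((tens_bilin U V).1 _)) /=.
under eq_bigr do rewrite (lin_sum _ _ ((tens_bilin U V).2 _)) /=.
rewrite pair_bigA /= -big_split; apply: eq_bigr => p _ /=.
rewrite scalerDl -scalerA; congr (_ + _).
by rewrite (linZ ((tens_bilin U V).1 _)) (linZ ((tens_bilin U V).2 _)).
Qed.
End Findim.

Section Sweedler.
Variable F : fieldType.

Definition trilin (U V W X : lmodType F) (f : U -> V -> W -> X) : Prop :=
  [/\ forall v w, linear (fun u => f u v w),
      forall u w, linear (fun v => f u v w) & forall u v, linear (fun w => f u v w)].

Lemma tsum_exch (U V U' V' W : lmodType F) (s : tensor U V) (t : tensor U' V')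
    (f : U -> V -> U' -> V' -> W) :
  \sw_(x, y <- s) \sw_(u, v <- t) f x y u v = \sw_(u, v <- t) \sw_(x, y <- s) f x y u v.
Proof. by rewrite /tsum /formal_sum exchange_big. Qed.

Lemma tsum_trilin (U V W X : lmodType F) (f : U -> V -> W -> X) :
  trilin f -> bilin (fun x p => \sw_(u, v <- p) f x u v).
Proof. by move=> [f1 f2 f3]; linp. Qed.

Lemma tsumZ (U V W : lmodType F) (t : tensor U V) (f : U -> V -> W) c :
  \sw_(x, y <- t) (c *: f x y) = c *: \sw_(x, y <- t) f x y.
Proof. by rewrite /tsum /formal_sum scaler_sumr. Qed.

Section TMul.
Variable A : algType F.
Definition tmul (s t : tensor A A) : tensor A A :=
  \sw_(a, b <- s) \sw_(c, d <- t) tens (a * c) (b * d).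
Lemma tmul_bilin : bilin tmul.
Proof. rewrite /tmul; linp. Qed.
Lemma tmul_tens a b c d : tmul (tens a b) (tens c d) = tens (a * c) (b * d).
Proof. by rewrite /tmul !tsum_tens; linp. Qed.
End TMul.
End Sweedler.
#[global] Hint Resolve tmul_bilin : bil.

Record coalgebra (F : fieldType) (C : lmodType F) := Coalgebra {
  comul : {linear C -> tensor C C};
  counit : {linear C -> F^o};
  comulA : forall a : C,
    \sw_(x, y <- comul a) \sw_(u, v <- comul x) tens u (tens v y) =
    \sw_(x, y <- comul a) \sw_(u, v <- comul y) tens x (tens u v);
  counitl : forall a : C, \sw_(x, y <- comul a) ((counit x : F) *: y) = a;
  counitr : forall a : C, \sw_(x, y <- comul a) ((counit y : F) *: x) = a
}.

(* In the axioms on comul 1, both sides are read in A (x) (A (x) A).  An algType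
   is a nonzero algebra. *)
Record weak_hopf_algebra (F : fieldType) := WeakHopfAlgebra {
  wh_alg :> algType F;
  wh_coalg : coalgebra wh_alg;
  wh_antipode : {linear wh_alg -> wh_alg};
  wh_comulM : forall a b : wh_alg,
    comul wh_coalg (a * b) = tmul (comul wh_coalg a) (comul wh_coalg b);
  wh_comul1 :
    \sw_(x, y <- comul wh_coalg 1) \sw_(u, v <- comul wh_coalg x) tens u (tens v y) =
    \sw_(x, y <- comul wh_coalg 1) \sw_(u, v <- comul wh_coalg 1)
      tens x (tens (y * u) v);
  wh_comul1' :
    \sw_(x, y <- comul wh_coalg 1) \sw_(u, v <- comul wh_coalg x) tens u (tens v y) =
    \sw_(x, y <- comul wh_coalg 1) \sw_(u, v <- comul wh_coalg 1)
      tens x (tens (u * y) v);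
  wh_counitM : forall a b c : wh_alg,
    counit wh_coalg (a * b * c) =
    \sw_(x, y <- comul wh_coalg b)
      (counit wh_coalg (a * x) * counit wh_coalg (y * c) : F^o);
  wh_counitM' : forall a b c : wh_alg,
    counit wh_coalg (a * b * c) =
    \sw_(x, y <- comul wh_coalg b)
      (counit wh_coalg (a * y) * counit wh_coalg (x * c) : F^o);
  wh_antipodet : forall a : wh_alg,
    \sw_(x, y <- comul wh_coalg a) (x * wh_antipode y) =
    \sw_(x, y <- comul wh_coalg 1) ((counit wh_coalg (x * a) : F) *: y);
  wh_antipodes : forall a : wh_alg,
    \sw_(x, y <- comul wh_coalg a) (wh_antipode x * y) =
    \sw_(x, y <- comul wh_coalg 1) ((counit wh_coalg (a * y) : F) *: x);
  wh_antipodeM : forall a : wh_alg,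
    \sw_(x, y <- comul wh_coalg a) \sw_(u, v <- comul wh_coalg y)
      (wh_antipode x * u * wh_antipode v) = wh_antipode a
}.

Section TriRules.
Variables (F : fieldType) (A : lmodType F) (W : lmodType F).
Lemma tri_eq (t t' : tensor A (tensor A A)) (f : A -> A -> A -> W) : trilin f ->
  t = t' -> \sw_(x, p <- t) \sw_(u, v <- p) f x u v =
            \sw_(x, p <- t') \sw_(u, v <- p) f x u v.
Proof. by move=> _ ->. Qed.

Lemma tri_push (t : tensor A A) (g : A -> A -> tensor A (tensor A A))
    (f : A -> A -> A -> W) : trilin f ->
  \sw_(x, p <- tsum t g) \sw_(u, v <- p) f x u v =
  \sw_(x, y <- t) (\sw_(x', p <- g x y) \sw_(u, v <- p) f x' u v).
Proof.
move=> tf; rewrite (lin_tsum (g := fun z => tsum z _)) //.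
exact/tsum_linear/tsum_trilin.
Qed.

Lemma tri_tens (f : A -> A -> A -> W) a b c : trilin f ->
  \sw_(x, p <- tens a (tens b c)) \sw_(u, v <- p) f x u v = f a b c.
Proof.
move=> tf; rewrite tsum_tens; last exact: tsum_trilin.
by rewrite tsum_tens //; case: tf => *; linp.
Qed.

Lemma tri2 (s : tensor A A) (t : A -> A -> tensor A A)
    (g1 g2 g3 : A -> A -> A -> A -> A) (f : A -> A -> A -> W) : trilin f ->
  \sw_(x, p <- \sw_(x, y <- s) \sw_(u, v <- t x y)
     tens (g1 x y u v) (tens (g2 x y u v) (g3 x y u v)))
   \sw_(u, v <- p) f x u v =
  \sw_(x, y <- s) \sw_(u, v <- t x y) f (g1 x y u v) (g2 x y u v) (g3 x y u v).
Proof.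
move=> tf; rewrite tri_push //; apply: eq_tsum => x y.
by rewrite tri_push //; apply: eq_tsum => u v; rewrite tri_tens.
Qed.
Lemma swA_coalg (C : coalgebra A) (f : A -> A -> A -> W) a : trilin f ->
  \sw_(x, y <- comul C a) \sw_(u, v <- comul C x) f u v y =
  \sw_(x, y <- comul C a) \sw_(u, v <- comul C y) f x u v.
Proof. by move=> tf; move/(tri_eq tf): (comulA C a); rewrite !tri2. Qed.
End TriRules.

Section WeakHopf.
Variables (F : fieldType) (A : weak_hopf_algebra F).
Local Notation D := (comul (wh_coalg A)).
Local Notation e := (counit (wh_coalg A)).
Local Notation S := (wh_antipode A).

Definition epst (a : A) : A := \sw_(x, y <- D a) (x * S y).
Fact epst_linear : linear epst. Proof. rewrite /epst; linp. Qed.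
HB.instance Definition _ := GRing.isLinear.Build F A A _ epst epst_linear.

Definition epss (a : A) : A := \sw_(x, y <- D a) (S x * y).
Fact epss_linear : linear epss. Proof. rewrite /epss; linp. Qed.
HB.instance Definition _ := GRing.isLinear.Build F A A _ epss epss_linear.

Lemma epstE a : epst a = \sw_(x, y <- D 1) ((e (x * a) : F) *: y).
Proof. exact: wh_antipodet. Qed.
Lemma epssE a : epss a = \sw_(x, y <- D 1) ((e (a * y) : F) *: x).
Proof. exact: wh_antipodes. Qed.

Section Rules.
Variable W : lmodType F.

Lemma swA (f : A -> A -> A -> W) a : trilin f ->
  \sw_(x, y <- D a) \sw_(u, v <- D x) f u v y =
  \sw_(x, y <- D a) \sw_(u, v <- D y) f x u v.
Proof. exact: swA_coalg. Qed.

Lemma sw1 (f : A -> A -> A -> W) : trilin f ->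
  \sw_(x, y <- D 1) \sw_(u, v <- D x) f u v y =
  \sw_(x, y <- D 1) \sw_(u, v <- D 1) f x (y * u) v.
Proof. by move=> tf; move/(tri_eq tf): (wh_comul1 A); rewrite !tri2. Qed.

Lemma sw1' (f : A -> A -> A -> W) : trilin f ->
  \sw_(x, y <- D 1) \sw_(u, v <- D x) f u v y =
  \sw_(x, y <- D 1) \sw_(u, v <- D 1) f x (u * y) v.
Proof. by move=> tf; move/(tri_eq tf): (wh_comul1' A); rewrite !tri2. Qed.

Lemma swM (f : A -> A -> W) a b : bilin f ->
  \sw_(x, y <- D (a * b)) f x y =
  \sw_(x, y <- D a) \sw_(u, v <- D b) f (x * u) (y * v).
Proof.
move=> bf; rewrite wh_comulM /tmul.
rewrite (lin_tsum (g := fun z => tsum z _)); last exact: tsum_linear.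
apply: eq_tsum => x y.
rewrite (lin_tsum (g := fun z => tsum z _)); last exact: tsum_linear.
by apply: eq_tsum => u v; rewrite tsum_tens.
Qed.

Lemma sw1l (f : A -> A -> W) a : bilin f ->
  \sw_(x, y <- D 1) \sw_(u, v <- D a) f (x * u) (y * v) = \sw_(x, y <- D a) f x y.
Proof. by move=> bf; rewrite -swM // mul1r. Qed.

Lemma sw1r (f : A -> A -> W) a : bilin f ->
  \sw_(x, y <- D a) \sw_(u, v <- D 1) f (x * u) (y * v) = \sw_(x, y <- D a) f x y.
Proof. by move=> bf; rewrite -swM // mulr1. Qed.

Lemma swel (f : A -> W) a : linear f ->
  \sw_(x, y <- D a) ((e x : F) *: f y) = f a.
Proof.
move=> lf; rewrite -[in RHS](counitl (wh_coalg A) a) (lin_tsum _ _ lf).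
by apply: eq_tsum => x y; rewrite (linZ lf).
Qed.

Lemma swer (f : A -> W) a : linear f ->
  \sw_(x, y <- D a) ((e y : F) *: f x) = f a.
Proof.
move=> lf; rewrite -[in RHS](counitr (wh_coalg A) a) (lin_tsum _ _ lf).
by apply: eq_tsum => x y; rewrite (linZ lf).
Qed.
End Rules.

Lemma eM a c : e (a * c) = \sw_(x, y <- D 1) (e (a * x) * e (y * c) : F^o).
Proof. by rewrite -wh_counitM mulr1. Qed.
Lemma eM' a c : e (a * c) = \sw_(x, y <- D 1) (e (a * y) * e (x * c) : F^o).
Proof. by rewrite -wh_counitM' mulr1. Qed.

Lemma e_epst a b : e (a * epst b) = e (a * b).
Proof.
rewrite epstE (lin_tsum _ _ (g := fun z => e (a * z))); last by linp.
rewrite [RHS]eM'; apply: eq_tsum => x y /=.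
by rewrite -scalerAr linearZ /= mulrC.
Qed.

Lemma epst_mul a b : epst (a * epst b) = epst (a * b).
Proof.
by rewrite epstE [RHS]epstE; apply: eq_tsum => x y; rewrite !mulrA e_epst.
Qed.

Lemma epst_id a : epst (epst a) = epst a.
Proof. by rewrite -[X in epst X]mul1r epst_mul mul1r. Qed.

Lemma epst1 : epst 1 = 1.
Proof.
rewrite epstE; under eq_tsum do rewrite mulr1.
exact: (counitl (wh_coalg A) 1).
Qed.

Section Rules1.
Variable W : lmodType F.

Lemma sw_epss1 (f : A -> A -> W) : bilin f ->
  \sw_(x, y <- D 1) f (epss x) y = \sw_(x, y <- D 1) f x y.
Proof.
move=> bf; have [f1 f2] := bf.
pose g u v y := (e v : F) *: f u y.
have tg : trilin g by split=> ? ? /=; rewrite /g; linp.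
transitivity (\sw_(x, y <- D 1) \sw_(u, v <- D x) g u v y).
  rewrite (sw1' tg) /g tsum_exch; apply: eq_tsum => x y.
  rewrite epssE (lin_tsum _ _ (g := f^~ y)); last exact: f1.
  by apply: eq_tsum => u v; rewrite (linZ (f1 y)).
by apply: eq_tsum => x y; rewrite /g (swer _ (f1 y)).
Qed.

Lemma sw_S1 (f : A -> A -> W) : bilin f ->
  \sw_(x, y <- D 1) f (S x) y = \sw_(x, y <- D 1) f (epst x) y.
Proof.
move=> bf; have [f1 f2] := bf.
pose g u v y := f (epss u * S v) y.
have tg : trilin g by split=> ? ? /=; rewrite /g; linp.
pose h u v y := f (u * S v) y.
have th : trilin h by split=> ? ? /=; rewrite /h; linp.
transitivity (\sw_(x, y <- D 1) \sw_(u, v <- D x) g u v y).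
  apply: eq_tsum => x y; rewrite -(lin_tsum _ _ (g := f^~ y)); last exact: f1.
  congr f; rewrite -wh_antipodeM.
  rewrite -(swA (f := fun a b c => S a * b * S c)); last by split=> *; linp.
  apply: eq_tsum => u v; rewrite /epss (lin_tsum _ _ (g := fun z => z * S v)) //.
  linp.
rewrite (swA _ tg) (sw_epss1 (f := fun x y => \sw_(u, v <- D y) f (x * S u) v)).
  rewrite -(swA _ th); apply: eq_tsum => x y.
  by rewrite /h /epst (lin_tsum _ _ (g := f^~ y)).
linp.
Qed.

Lemma sw_epstS1 (f : A -> A -> W) : bilin f ->
  \sw_(x, y <- D 1) f (epst (S x)) y = \sw_(x, y <- D 1) f (S x) y.
Proof.
move=> bf; rewrite (sw_S1 (f := fun x y => f (epst x) y)); last by linp.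
by rewrite sw_S1 //; apply: eq_tsum => x y; rewrite epst_id.
Qed.

Lemma swt (f : A -> A -> W) z : bilin f -> epst z = z ->
  \sw_(x, y <- D z) f x y = \sw_(x, y <- D 1) f (x * z) y.
Proof.
move=> bf ez; have [f1 f2] := bf.
have tg : trilin (fun u v y => (e (u * z) : F) *: f v y).
  by split=> ? ? /=; linp.
rewrite -[X in D X]ez epstE.
rewrite (lin_tsum _ _ (g := fun z => \sw_(x, y <- D z) f x y)); last by linp.
transitivity (\sw_(x, y <- D 1) \sw_(u, v <- D y) ((e (x * z) : F) *: f u v)).
  apply: eq_tsum => x y; rewrite (linZ (f := fun z => \sw_(x, y <- D z) f x y)).
    by rewrite (lin_tsum _ _ (g := fun w => _ *: w)) //; linp.
  by linp.
rewrite -(swA _ tg) (sw1' tg) tsum_exch; apply: eq_tsum => x y.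
rewrite -[in RHS]ez epstE (lin_tsum _ _ (g := fun w => f (x * w) y)); last by linp.
by apply: eq_tsum => u v; rewrite -scalerAr (linZ (f1 y)).
Qed.
End Rules1.

Lemma epst_act a z : epst z = z -> \sw_(x, y <- D a) (epst (x * z) * y) = a * z.
Proof.
move=> ez; transitivity (\sw_(x, y <- D a) ((e (x * z) : F) *: y)).
  transitivity (\sw_(u, v <- D 1) \sw_(x, y <- D a) ((e (u * x * z) : F) *: (v * y))).
    rewrite tsum_exch; apply: eq_tsum => x y.
    rewrite epstE (lin_tsum _ _ (g := fun w => w * y)); last by linp.
    by apply: eq_tsum => u v; rewrite mulrA scalerAl.
  by rewrite (sw1l (f := fun x y => (e (x * z) : F) *: y)) //; linp.
rewrite -[RHS](counitl (wh_coalg A)).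
rewrite (swM (f := fun x y => (e x : F) *: y)); last by linp.
rewrite -(sw1r (f := fun x y => (e (x * z) : F) *: y)); last by linp.
apply: eq_tsum => x y.
rewrite (swt (f := fun u v => (e (x * u) : F) *: (y * v))) //; last by linp.
by apply: eq_tsum => u v; rewrite mulrA.
Qed.

(* On A_t this is the inverse of the bijection S : A_s -> A_t. *)
Definition epsr (a : A) : A := \sw_(x, y <- D 1) ((e (y * a) : F) *: x).
Fact epsr_linear : linear epsr. Proof. rewrite /epsr; linp. Qed.
HB.instance Definition _ := GRing.isLinear.Build F A A _ epsr epsr_linear.

Lemma epsr_epst a : epsr (epst a) = epsr a.
Proof. by apply: eq_tsum => x y; rewrite e_epst. Qed.

Lemma epsr1 : epsr 1 = 1.
Proof.
rewrite /epsr; under eq_tsum do rewrite mulr1.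
exact: (counitr (wh_coalg A) 1).
Qed.

Lemma epsr_mul a z : \sw_(x, y <- D a) ((e (y * z) : F) *: x) = a * epsr z.
Proof.
rewrite -(sw1r (f := fun x y => (e (y * z) : F) *: x)); last by linp.
transitivity (\sw_(x, y <- D a) \sw_(u, v <- D 1) \sw_(v1, v2 <- D v)
   ((e (y * v1) * e (v2 * z) : F) *: (x * u))).
  apply: eq_tsum => x y; apply: eq_tsum => u v.
  rewrite wh_counitM (lin_tsum _ _ (g := fun w : F^o => (w : F) *: (x * u))) //.
  by linp.
transitivity (\sw_(p, q <- D 1) \sw_(x, y <- D a) \sw_(u, v <- D p)
   ((e (y * v) * e (q * z) : F) *: (x * u))).
  rewrite [RHS]tsum_exch; apply: eq_tsum => x y.
  rewrite -(swA (f := fun u v w => (e (y * v) * e (w * z) : F) *: (x * u))) //.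
  by split=> ? ? /=; linp.
rewrite /epsr (lin_tsum _ _ (g := fun w => a * w)); last by linp.
apply: eq_tsum => p q.
rewrite -(swM (f := fun x y => (e y * e (q * z) : F) *: x)); last by linp.
under eq_tsum do rewrite mulrC -scalerA.
rewrite -(lin_tsum (g := fun w : A => (e (q * z) : F) *: w)); last by linp.
by rewrite (counitr (wh_coalg A)) scalerAr.
Qed.

Lemma epsr_act a z : \sw_(x, y <- D a) (epsr (y * z) * x) = a * epsr z.
Proof.
rewrite -epsr_mul -(sw1l (f := fun x y => (e (y * z) : F) *: x)); last by linp.
rewrite tsum_exch; apply: eq_tsum => x y.
rewrite /epsr (lin_tsum _ _ (g := fun w => w * x)); last by linp.
by apply: eq_tsum => u v; rewrite -scalerAl mulrA.
Qed.

Section Rules2.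
Variable W : lmodType F.
Lemma sw_epst (f : A -> A -> W) a : bilin f ->
  \sw_(x, y <- D a) f (epst x) y = \sw_(x, y <- D 1) f (epst x) (y * a).
Proof.
move=> bf; have [f1 f2] := bf.
rewrite -(sw1l (f := fun x y => f (epst x) y)); last by linp.
transitivity (\sw_(x, y <- D 1) \sw_(x1, x2 <- D x) \sw_(u, v <- D a)
   ((e (x2 * u) : F) *: f (epst x1) (y * v))).
  apply: eq_tsum => x y; rewrite tsum_exch; apply: eq_tsum => u v.
  rewrite epstE (lin_tsum _ _ (f1 _)).
  transitivity (\sw_(p, q <- D 1) \sw_(x1, x2 <- D x)
     ((e (x2 * u) : F) *: ((e (p * x1) : F) *: f q (y * v)))).
    apply: eq_tsum => p q; rewrite mulrA wh_counitM.
    rewrite (linZ (f1 _)) (lin_tsum _ _ (g := fun w : F^o => (w : F) *: f q (y * v)));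
      last by linp.
    by apply: eq_tsum => x1 x2; rewrite scalerA mulrC.
  rewrite tsum_exch; apply: eq_tsum => x1 x2.
  rewrite -(lin_tsum _ _ (g := fun w : W => _ *: w)); last by linp.
  congr (_ *: _); rewrite epstE (lin_tsum _ _ (f1 _)).
  by apply: eq_tsum => p q; rewrite (linZ (f1 _)).
rewrite (swA (f := fun x1 x2 y => \sw_(u, v <- D a)
   ((e (x2 * u) : F) *: f (epst x1) (y * v)))); last by split=> ? ? /=; linp.
apply: eq_tsum => x y.
rewrite -(swM (f := fun p q => (e p : F) *: f (epst x) q)); last by linp.
by rewrite (swel (f := fun q => f (epst x) q)).
Qed.

Lemma sw_epst_mulr (f : A -> A -> W) z : bilin f -> epst z = z ->
  \sw_(x, y <- D 1) f x (epst (y * z)) = \sw_(x, y <- D 1) f x (y * z).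
Proof.
move=> bf ez; have [f1 f2] := bf.
transitivity (\sw_(x, y <- D 1) \sw_(u, v <- D z) ((e (y * u) : F) *: f x v)).
  have tg : trilin (fun x m q => (e (m * z) : F) *: f x q) by split=> ? ? /=; linp.
  transitivity (\sw_(x, y <- D 1) \sw_(u, v <- D 1) ((e (u * y * z) : F) *: f x v)).
    apply: eq_tsum => x y; rewrite epstE (lin_tsum _ _ (f2 _)).
    by apply: eq_tsum => u v; rewrite (linZ (f2 _)) mulrA.
  rewrite -(sw1' tg) (sw1 tg); apply: eq_tsum => x y.
  rewrite (swt (f := fun u v => (e (y * u) : F) *: f x v)) //; last by linp.
  by apply: eq_tsum => u v; rewrite mulrA.
symmetry.
transitivity (\sw_(x, y <- D 1) \sw_(p, q <- D y) \sw_(u, v <- D z)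
   ((e (p * u) : F) *: f x (q * v))).
  apply: eq_tsum => x y; rewrite -(swM (f := fun p q => (e p : F) *: f x q)); last by linp.
  by rewrite (swel (f := fun q => f x q)).
have tg : trilin (fun x p q => \sw_(u, v <- D z) ((e (p * u) : F) *: f x (q * v))).
  by split=> ? ? /=; linp.
rewrite -(swA _ tg) (sw1 tg); apply: eq_tsum => x y.
rewrite -(sw1l (f := fun u v => (e (y * u) : F) *: f x v)); last by linp.
by apply: eq_tsum => p q; apply: eq_tsum => u v; rewrite mulrA.
Qed.

Lemma sw_epsr (f : A -> A -> W) z : bilin f ->
  \sw_(x, y <- D 1) f (x * epsr z) y = \sw_(x, y <- D 1) f x (epst (y * z)).
Proof.
move=> bf; have [f1 f2] := bf.
have tg : trilin (fun u v y => (e (v * z) : F) *: f u y) by split=> ? ? /=; linp.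
transitivity (\sw_(x, y <- D 1) \sw_(u, v <- D x) ((e (v * z) : F) *: f u y)).
  apply: eq_tsum => x y; rewrite -epsr_mul (lin_tsum _ _ (f1 _)).
  by apply: eq_tsum => u v; rewrite (linZ (f1 _)).
rewrite (sw1' tg); apply: eq_tsum => x y.
rewrite epstE (lin_tsum _ _ (f2 _)).
by apply: eq_tsum => u v; rewrite (linZ (f2 _)) mulrA.
Qed.
End Rules2.
End WeakHopf.

Section Rep.
Variables (F : fieldType) (B : algType F).

Record rep := Rep {
  rep_sort :> lmodType F;
  ract : B -> rep_sort -> rep_sort;
  ract_bilin : bilin ract;
  ract1 : forall m, ract 1 m = m;
  ractM : forall a b m, ract (a * b) m = ract a (ract b m);
  rep_findim : findim rep_sort
}.
Arguments ract {r} _ _.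

Record rhom (M N : rep) := RHom {
  rhom_fun :> {linear M -> N};
  rhomP : forall a m, rhom_fun (ract a m) = ract a (rhom_fun m)
}.

Definition mk_rhom (M N : rep) (f : M -> N) (lf : linear f)
    (fP : forall a m, f (ract a m) = ract a (f m)) : rhom M N :=
  let g := HB.pack_for {linear M -> N} f (GRing.isLinear.Build F M N _ f lf) in
  @RHom M N g fP.

Lemma rhomL (M N : rep) (f : rhom M N) : linear f.
Proof. exact: linearP. Qed.

Definition rid (M : rep) : rhom M M :=
  @mk_rhom M M id (@lin_id F M) (fun _ _ => erefl).

Fact rcomp_linear (M N P : rep) (g : rhom N P) (f : rhom M N) :
  linear (fun m => g (f m)).
Proof. linp. Qed.
Fact rcomp_act (M N P : rep) (g : rhom N P) (f : rhom M N) a m :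
  g (f (ract a m)) = ract a (g (f m)).
Proof. by rewrite !rhomP. Qed.
Definition rcomp (M N P : rep) (g : rhom N P) (f : rhom M N) : rhom M P :=
  mk_rhom (rcomp_linear g f) (rcomp_act g f).

Fact rlin_linear (M N : rep) (c : F) (f g : rhom M N) :
  linear (fun m => c *: f m + g m).
Proof.
move=> k x y /=; rewrite (rhomL f) (rhomL g) !scalerDr !scalerA (mulrC c).
by rewrite addrACA.
Qed.
Fact rlin_act (M N : rep) (c : F) (f g : rhom M N) a m :
  c *: f (ract a m) + g (ract a m) = ract a (c *: f m + g m).
Proof. by rewrite !rhomP (ract_bilin N).2. Qed.
Definition rlin (M N : rep) (c : F) (f g : rhom M N) : rhom M N :=
  mk_rhom (rlin_linear c f g) (rlin_act c f g).

Definition riso (M N : rep) (f : rhom M N) : Prop :=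
  exists g : rhom N M, cancel f g /\ cancel g f.

Definition short_exact (M N P : rep) (f : rhom M N) (g : rhom N P) : Prop :=
  [/\ injective f,
      forall n, g n = 0 <-> exists m, n = f m
    & forall p, exists n, p = g n].

Lemma riso_bij (M N : rep) (f : rhom M N) (g : N -> M) :
  cancel f g -> cancel g f -> riso f.
Proof.
move=> fK gK; have lg : linear g.
  by move=> c x y; apply: (can_inj fK); rewrite linearP !gK.
have gP a n : g (ract a n) = ract a (g n).
  by apply: (can_inj fK); rewrite rhomP !gK.
by exists (mk_rhom lg gP).
Qed.

End Rep.
Arguments ract {F B r} _ _.
Notation "a \act m" := (ract a m) (at level 40, left associativity).
#[global] Hint Resolve ract_bilin : bil.

Section TensorAct.
Variables (F : fieldType) (B : algType F).

(* The action of B (x) B on M (x) N, (a (x) b)(m (x) n) = am (x) bn. *)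
Definition tactf (M N : lmodType F) (am : B -> M -> M) (an : B -> N -> N)
    (t : tensor B B) (v : tensor M N) : tensor M N :=
  \sw_(a, b <- t) \sw_(m, n <- v) tens (am a m) (an b n).

Section Lmod.
Variables (M N P : lmodType F).
Variables (am : B -> M -> M) (an : B -> N -> N) (ap : B -> P -> P).
Hypotheses (bm : bilin am) (bn : bilin an) (bp : bilin ap).

Lemma tactf_bilin : bilin (tactf am an).
Proof. rewrite /tactf; linp. Qed.
Lemma tactfE t m n :
  tactf am an t (tens m n) = \sw_(a, b <- t) tens (am a m) (an b n).
Proof. by apply: eq_tsum => a b; rewrite tsum_tens //; linp. Qed.
Lemma tactf_tens a b m n :
  tactf am an (tens a b) (tens m n) = tens (am a m) (an b n).
Proof. by rewrite tactfE tsum_tens //; linp. Qed.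
End Lmod.

Lemma tassoc_tactf (M N P : lmodType F) (am : B -> M -> M) (an : B -> N -> N)
    (ap : B -> P -> P) (C : coalgebra B) a v :
  bilin am -> bilin an -> bilin ap ->
  tassoc (tactf (fun b => tactf am an (comul C b)) ap (comul C a) v) =
  tactf am (fun b => tactf an ap (comul C b)) (comul C a) (tassoc v).
Proof.
move=> bm bn bp.
have b12 : bilin (tactf am an) by apply: tactf_bilin.
have b23 : bilin (tactf an ap) by apply: tactf_bilin.
have bc12 : bilin (fun b => tactf am an (comul C b)) by linp.
have bc23 : bilin (fun b => tactf an ap (comul C b)) by linp.
have b1 := tactf_bilin bc12 bp; have b2 := tactf_bilin bm bc23.
move: v; apply: tens_ext; [linp|linp|] => v p.
move: v; apply: tens_ext; [linp|linp|] => m n.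
rewrite tassoc_tens !tactfE //.
transitivity (\sw_(x, y <- comul C a) \sw_(u, v <- comul C x)
   tens (am u m) (tens (an v n) (ap y p))).
  rewrite (lin_tsum _ _ (g := @tassoc F M N P)); last by linp.
  apply: eq_tsum => x y; rewrite tactfE //.
  rewrite (lin_tsum _ _ (g := fun t => tassoc (tens t (ap y p)))); last by linp.
  by apply: eq_tsum => u v; rewrite tassoc_tens.
rewrite (swA_coalg C (f := fun u v y => tens (am u m) (tens (an v n) (ap y p)))).
  apply: eq_tsum => x y; rewrite tactfE //.
  by rewrite (lin_tsum _ _ (g := fun t => tens (am x m) t)); linp.
by split=> ? ? /=; linp.
Qed.

Section RepAct.
Variables M N : rep B.
Definition tact (t : tensor B B) (v : tensor M N) : tensor M N :=
  tactf (@ract F B M) (@ract F B N) t v.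

Lemma tact_bilin : bilin tact.
Proof. exact: tactf_bilin (ract_bilin M) (ract_bilin N). Qed.
Hint Resolve tact_bilin : bil.

Fact tact_linear t : linear (tact t).
Proof. exact: tact_bilin.2. Qed.
HB.instance Definition _ t :=
  GRing.isLinear.Build F _ _ _ (tact t) (tact_linear t).

Lemma tactE t m n : tact t (tens m n) = \sw_(a, b <- t) tens (a \act m) (b \act n).
Proof. exact: tactfE (ract_bilin M) (ract_bilin N) _ _ _. Qed.

Lemma tact_tens a b m n : tact (tens a b) (tens m n) = tens (a \act m) (b \act n).
Proof. by rewrite tactE tsum_tens //; linp. Qed.

Lemma tactM s t v : tact (tmul s t) v = tact s (tact t v).
Proof.
move: s; apply: tens_ext; [linp|linp|] => a b.
move: t; apply: tens_ext; [linp|linp|] => c d.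
move: v; apply: tens_ext; [linp|linp|] => m n.
by rewrite tmul_tens !tact_tens !ractM.
Qed.
End RepAct.
End TensorAct.
#[global] Hint Resolve tact_bilin : bil.

Lemma tmap_tact (F : fieldType) (B : algType F) (M M' N N' : rep B)
    (f : rhom M M') (g : rhom N N') t v :
  tmap f g (tact t v) = tact t (tmap f g v).
Proof.
move: t; apply: tens_ext; [linp|linp|] => a b.
move: v; apply: tens_ext; [linp|linp|] => m n.
by rewrite tact_tens !tmap_tens tact_tens !rhomP.
Qed.

(* Monoidal structures on the category Rep(B) of finite-dimensional left
   B-modules; morphisms are compared pointwise. *)
Record monoidal_data (F : fieldType) (B : algType F) := MonoidalData {
  mtens : rep B -> rep B -> rep B;
  mtensh : forall M M' N N' : rep B, rhom M M' -> rhom N N' ->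
    rhom (mtens M N) (mtens M' N');
  munit : rep B;
  massoc : forall M N P, rhom (mtens (mtens M N) P) (mtens M (mtens N P));
  mlunit : forall M, rhom (mtens munit M) M;
  mrunit : forall M, rhom (mtens M munit) M
}.

Record monoidal_axioms (F : fieldType) (B : algType F) (mB : monoidal_data B) : Prop :=
  MonoidalAxioms {
  mtensh_id : forall M N, mtensh mB (rid M) (rid N) =1 rid (mtens mB M N);
  mtensh_comp : forall (M M' M'' N N' N'' : rep B)
    (f' : rhom M' M'') (f : rhom M M') (g' : rhom N' N'') (g : rhom N N'),
    mtensh mB (rcomp f' f) (rcomp g' g) =1 rcomp (mtensh mB f' g') (mtensh mB f g);
  massoc_iso : forall M N P, riso (massoc mB M N P);
  mlunit_iso : forall M, riso (mlunit mB M);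
  mrunit_iso : forall M, riso (mrunit mB M);
  massoc_nat : forall (M M' N N' P P' : rep B)
    (f : rhom M M') (g : rhom N N') (h : rhom P P'),
    rcomp (massoc mB M' N' P') (mtensh mB (mtensh mB f g) h) =1
    rcomp (mtensh mB f (mtensh mB g h)) (massoc mB M N P);
  mlunit_nat : forall (M M' : rep B) (f : rhom M M'),
    rcomp (mlunit mB M') (mtensh mB (rid (munit mB)) f) =1 rcomp f (mlunit mB M);
  mrunit_nat : forall (M M' : rep B) (f : rhom M M'),
    rcomp (mrunit mB M') (mtensh mB f (rid (munit mB))) =1 rcomp f (mrunit mB M);
  mpentagon : forall M N P Q,
    rcomp (massoc mB M N (mtens mB P Q)) (massoc mB (mtens mB M N) P Q) =1
    rcomp (mtensh mB (rid M) (massoc mB N P Q))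
      (rcomp (massoc mB M (mtens mB N P) Q) (mtensh mB (massoc mB M N P) (rid Q)));
  mtriangle : forall M N,
    rcomp (mtensh mB (rid M) (mlunit mB N)) (massoc mB M (munit mB) N) =1
    mtensh mB (mrunit mB M) (rid N)
}.

Record monoidal (F : fieldType) (B : algType F) := Monoidal {
  monoidal_str :> monoidal_data B;
  monoidalP : monoidal_axioms monoidal_str
}.

(* An exact, faithful, F-linear, strong monoidal functor (fob, fmap), its
   structure isomorphisms phi0 and phi2 being oriented out of the images of the
   unit and of the tensor products. *)
Record tensor_functor (F : fieldType) (B C : algType F)
    (mB : monoidal B) (mC : monoidal C)
    (fob : rep B -> rep C)
    (fmap : forall M N : rep B, rhom M N -> rhom (fob M) (fob N))
    (phi0 : rhom (fob (munit mB)) (munit mC))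
    (phi2 : forall M N : rep B, rhom (fob (mtens mB M N)) (mtens mC (fob M) (fob N)))
  : Prop := TensorFunctor {
  tf_id : forall M, fmap _ _ (rid M) =1 rid (fob M);
  tf_comp : forall (M N P : rep B) (g : rhom N P) (f : rhom M N),
    fmap _ _ (rcomp g f) =1 rcomp (fmap _ _ g) (fmap _ _ f);
  tf_linear : forall (M N : rep B) (c : F) (f g : rhom M N),
    fmap _ _ (rlin c f g) =1 rlin c (fmap _ _ f) (fmap _ _ g);
  tf_faithful : forall (M N : rep B) (f g : rhom M N),
    fmap _ _ f =1 fmap _ _ g -> f =1 g;
  tf_exact : forall (M N P : rep B) (f : rhom M N) (g : rhom N P),
    short_exact f g -> short_exact (fmap _ _ f) (fmap _ _ g);
  tf_unit_iso : riso phi0;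
  tf_tens_iso : forall M N, riso (phi2 M N);
  tf_tens_nat : forall (M M' N N' : rep B) (f : rhom M M') (g : rhom N N'),
    rcomp (phi2 M' N') (fmap _ _ (mtensh mB f g)) =1
    rcomp (mtensh mC (fmap _ _ f) (fmap _ _ g)) (phi2 M N);
  tf_assoc : forall M N P,
    rcomp (massoc mC (fob M) (fob N) (fob P))
      (rcomp (mtensh mC (phi2 M N) (rid (fob P))) (phi2 (mtens mB M N) P)) =1
    rcomp (mtensh mC (rid (fob M)) (phi2 N P))
      (rcomp (phi2 M (mtens mB N P)) (fmap _ _ (massoc mB M N P)));
  tf_lunit : forall M,
    rcomp (mlunit mC (fob M))
      (rcomp (mtensh mC phi0 (rid (fob M))) (phi2 (munit mB) M)) =1
    fmap _ _ (mlunit mB M);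
  tf_runit : forall M,
    rcomp (mrunit mC (fob M))
      (rcomp (mtensh mC (rid (fob M)) phi0) (phi2 M (munit mB))) =1
    fmap _ _ (mrunit mB M)
}.

Record hopf_algebra (F : fieldType) := HopfAlgebra {
  ha_alg :> algType F;
  ha_coalg : coalgebra ha_alg;
  ha_antipode : {linear ha_alg -> ha_alg};
  ha_comulM : forall a b : ha_alg,
    comul ha_coalg (a * b) = tmul (comul ha_coalg a) (comul ha_coalg b);
  ha_comul1 : comul ha_coalg 1 = tens 1 1;
  ha_counitM : forall a b : ha_alg,
    counit ha_coalg (a * b) = (counit ha_coalg a : F) * counit ha_coalg b;
  ha_counit1 : counit ha_coalg 1 = 1;
  ha_antipodel : forall a : ha_alg,
    \sw_(x, y <- comul ha_coalg a) (ha_antipode x * y) = (counit ha_coalg a : F) *: 1;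
  ha_antipoder : forall a : ha_alg,
    \sw_(x, y <- comul ha_coalg a) (x * ha_antipode y) = (counit ha_coalg a : F) *: 1
}.

Section HopfRep.
Variables (F : fieldType) (H : hopf_algebra F).
Local Notation D := (comul (ha_coalg H)).
Local Notation e := (counit (ha_coalg H)).

Section Tens.
Variables M N : rep H.
Definition hact (a : H) (v : tensor M N) := tact (D a) v.
Fact hact_bilin : bilin hact.
Proof. rewrite /hact; linp. Qed.
Fact hact1 v : hact 1 v = v.
Proof.
rewrite /hact ha_comul1; move: v; apply: tens_ext; [linp|linp|] => m n.
by rewrite tact_tens !ract1.
Qed.
Fact hactM a b v : hact (a * b) v = hact a (hact b v).
Proof. by rewrite /hact ha_comulM tactM. Qed.
Definition htens : rep H :=
  Rep hact_bilin hact1 hactM (findim_tensor (rep_findim M) (rep_findim N)).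
End Tens.

Section TensHom.
Variables (M M' N N' : rep H) (f : rhom M M') (g : rhom N N').
Fact htensh_act a v :
  tmap f g (a \act v : htens M N) = a \act (tmap f g v : htens M' N').
Proof. exact: tmap_tact. Qed.
Definition htensh : rhom (htens M N) (htens M' N') :=
  @RHom F H (htens M N) (htens M' N') (tmap f g) htensh_act.
End TensHom.

Definition uact (a : H) (c : F^o) : F^o := (e a : F) * c.
Fact uact_bilin : bilin uact.
Proof. rewrite /uact; linp. Qed.
Fact uact1 c : uact 1 c = c.
Proof. by rewrite /uact ha_counit1 mul1r. Qed.
Fact uactM a b c : uact (a * b) c = uact a (uact b c).
Proof. by rewrite /uact ha_counitM mulrA. Qed.
Definition hunit : rep H := Rep uact_bilin uact1 uactM (findim_regular F).

Fact hassoc_act M N P a v :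
  tassoc (a \act v : htens (htens M N) P) =
  a \act (tassoc v : htens M (htens N P)).
Proof.
exact: tassoc_tactf _ _ (ract_bilin M) (ract_bilin N) (ract_bilin P).
Qed.
Definition hassoc M N P : rhom (htens (htens M N) P) (htens M (htens N P)) :=
  @RHom F H (htens (htens M N) P) (htens M (htens N P)) (@tassoc F M N P)
    (@hassoc_act M N P).

Definition hlun (M : lmodType F) (v : tensor F^o M) : M :=
  \sw_(c, m <- v) ((c : F) *: m).
Fact hlun_linear (M : lmodType F) : linear (@hlun M).
Proof. rewrite /hlun; linp. Qed.
HB.instance Definition _ M := GRing.isLinear.Build F _ _ _ (@hlun M) (@hlun_linear M).
Definition hrun (M : lmodType F) (v : tensor M F^o) : M :=
  \sw_(m, c <- v) ((c : F) *: m).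
Fact hrun_linear (M : lmodType F) : linear (@hrun M).
Proof. rewrite /hrun; linp. Qed.
HB.instance Definition _ M := GRing.isLinear.Build F _ _ _ (@hrun M) (@hrun_linear M).
Lemma hlun_tens (M : lmodType F) c m : @hlun M (tens c m) = (c : F) *: m.
Proof. by rewrite /hlun tsum_tens; linp. Qed.
Lemma hrun_tens (M : lmodType F) c m : @hrun M (tens m c) = (c : F) *: m.
Proof. by rewrite /hrun tsum_tens; linp. Qed.

Fact hlun_act (M : rep H) a (v : tensor F^o M) :
  hlun (@tact F H hunit M (D a) v) = a \act hlun v.
Proof.
have bu := uact_bilin; have bm := ract_bilin M.
rewrite /tact; change (@ract F H hunit) with uact.
have bt := tactf_bilin bu bm.
move: v; apply: tens_ext; [linp|linp|] => c m.
rewrite tactfE // hlun_tens (linZ (bm.2 _)).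
rewrite (lin_tsum _ _ (g := @hlun M)); last by linp.
transitivity (\sw_(x, y <- D a) (c *: ((e x : F) *: (y \act m)))).
  by apply: eq_tsum => x y; rewrite hlun_tens scalerA mulrC.
rewrite tsumZ.
rewrite -[in RHS](counitl (ha_coalg H) a) [in RHS](lin_tsum _ _ (g := fun w => w \act m));
  last by linp.
by congr (_ *: _); apply: eq_tsum => x y; rewrite (linZ (bm.1 _)).
Qed.
Fact hrun_act (M : rep H) a (v : tensor M F^o) :
  hrun (@tact F H M hunit (D a) v) = a \act hrun v.
Proof.
have bu := uact_bilin; have bm := ract_bilin M.
rewrite /tact; change (@ract F H hunit) with uact.
have bt := tactf_bilin bm bu.
move: v; apply: tens_ext; [linp|linp|] => m c.
rewrite tactfE // hrun_tens (linZ (bm.2 _)).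
rewrite (lin_tsum _ _ (g := @hrun M)); last by linp.
transitivity (\sw_(x, y <- D a) (c *: ((e y : F) *: (x \act m)))).
  by apply: eq_tsum => x y; rewrite hrun_tens scalerA mulrC.
rewrite tsumZ.
rewrite -[in RHS](counitr (ha_coalg H) a) [in RHS](lin_tsum _ _ (g := fun w => w \act m));
  last by linp.
by congr (_ *: _); apply: eq_tsum => x y; rewrite (linZ (bm.1 _)).
Qed.

Definition hlunit M : rhom (htens hunit M) M :=
  @RHom F H (htens hunit M) M (@hlun M) (@hlun_act M).
Definition hrunit M : rhom (htens M hunit) M :=
  @RHom F H (htens M hunit) M (@hrun M) (@hrun_act M).

Section Laws.
Variables (M M' M'' N N' N'' P P' Q : lmodType F).
Lemma tmap_id (v : tensor M N) : tmap idfun idfun v = v.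
Proof. by move: v; apply: tens_ext; [linp|linp|] => m n; rewrite tmap_tens. Qed.
Lemma tmap_comp (f' : {linear M' -> M''}) (f : {linear M -> M'})
    (g' : {linear N' -> N''}) (g : {linear N -> N'}) (v : tensor M N) :
  tmap (f' \o f) (g' \o g) v = tmap f' g' (tmap f g v).
Proof. by move: v; apply: tens_ext; [linp|linp|] => m n; rewrite !tmap_tens. Qed.
Lemma tassoc_nat (f : {linear M -> M'}) (g : {linear N -> N'})
    (h : {linear P -> P'}) (v : tensor (tensor M N) P) :
  tassoc (tmap (tmap f g) h v) = tmap f (tmap g h) (tassoc v).
Proof.
move: v; apply: tens_ext; [linp|linp|] => v p.
move: v; apply: tens_ext; [linp|linp|] => m n.
by rewrite !tmap_tens /= tmap_tens !tassoc_tens !tmap_tens /= tmap_tens.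
Qed.
Definition tassoc' (t : tensor M (tensor N P)) : tensor (tensor M N) P :=
  \sw_(u, p <- t) \sw_(v, w <- p) tens (tens u v) w.
Lemma tassoc'_linear : linear tassoc'. Proof. rewrite /tassoc'; linp. Qed.
Hint Resolve tassoc'_linear : bil.
Lemma tassoc'_tens x y z : tassoc' (tens x (tens y z)) = tens (tens x y) z.
Proof. by rewrite /tassoc' !tsum_tens; linp. Qed.
Lemma tassocK : cancel (@tassoc F M N P) tassoc'.
Proof.
apply: tens_ext; [move=> c x y; rewrite linearP; exact: tassoc'_linear|linp|] => v p.
move: v; apply: tens_ext; [|linp|] => [c x y|m n].
  by rewrite (tens_bilin _ _).1 linearP tassoc'_linear.
by rewrite tassoc_tens tassoc'_tens.
Qed.
Lemma tassoc'K : cancel tassoc' (@tassoc F M N P).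
Proof.
apply: tens_ext; [move=> c x y; rewrite tassoc'_linear linearP //|linp|] => m v.
move: v; apply: tens_ext; [|linp|] => [c x y|n p].
  by rewrite (tens_bilin _ _).2 tassoc'_linear linearP.
by rewrite tassoc'_tens tassoc_tens.
Qed.
Lemma tassoc_pentagon (v : tensor (tensor (tensor M N) P) Q) :
  tassoc (tassoc v) = tmap idfun (@tassoc F N P Q) (tassoc (tmap (@tassoc F M N P) idfun v)).
Proof.
move: v; apply: tens_ext; [linp|linp|] => v q.
move: v; apply: tens_ext; [linp|linp|] => v p.
move: v; apply: tens_ext; [linp|linp|] => m n.
by rewrite !(tassoc_tens, tmap_tens) /= !(tassoc_tens, tmap_tens) /= tassoc_tens.
Qed.
Lemma hlunK (v : tensor F^o M) : tens 1 (hlun v) = v.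
Proof.
move: v; apply: tens_ext; [linp|linp|] => c m.
by rewrite hlun_tens (linZ ((tens_bilin _ _).2 _)) -(linZ ((tens_bilin _ _).1 _)) [_ *: _]mulr1.
Qed.
Lemma hrunK (v : tensor M F^o) : tens (hrun v) 1 = v.
Proof.
move: v; apply: tens_ext; [linp|linp|] => m c.
by rewrite hrun_tens (linZ ((tens_bilin _ _).1 _)) -(linZ ((tens_bilin _ _).2 _)) [_ *: _]mulr1.
Qed.
Lemma hlun_nat (f : {linear M -> M'}) (v : tensor F^o M) :
  hlun (tmap idfun f v) = f (hlun v).
Proof.
by move: v; apply: tens_ext; [linp|linp|] => c m; rewrite tmap_tens !hlun_tens linearZ.
Qed.
Lemma hrun_nat (f : {linear M -> M'}) (v : tensor M F^o) :
  hrun (tmap f idfun v) = f (hrun v).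
Proof.
by move: v; apply: tens_ext; [linp|linp|] => c m; rewrite tmap_tens !hrun_tens linearZ.
Qed.
Lemma h_triangle (v : tensor (tensor M F^o) N) :
  tmap idfun (@hlun N) (tassoc v) = tmap (@hrun M) idfun v.
Proof.
move: v; apply: tens_ext; [linp|linp|] => v n.
move: v; apply: tens_ext; [linp|linp|] => m c.
rewrite tassoc_tens !tmap_tens /= hlun_tens hrun_tens.
by rewrite (linZ ((tens_bilin _ _).1 _)) (linZ ((tens_bilin _ _).2 _)).
Qed.
End Laws.

Definition hopf_monoidal_data : monoidal_data H :=
  MonoidalData htensh hassoc hlunit hrunit.
Fact hopf_monoidalP : monoidal_axioms hopf_monoidal_data.
Proof.
split.
- by move=> M N v; apply: tmap_id.
- by move=> *; move=> v; apply: tmap_comp.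
- move=> M N P; apply: (@riso_bij F H (htens (htens M N) P) (htens M (htens N P))
    (hassoc M N P) (@tassoc' M N P)); [exact: tassocK|exact: tassoc'K].
- move=> M; apply: (@riso_bij _ _ _ _ _ (fun m : M => tens (1 : F^o) m : htens hunit M)).
    by move=> v; apply: hlunK.
  by move=> m; rewrite /= hlun_tens scale1r.
- move=> M; apply: (@riso_bij _ _ _ _ _ (fun m : M => tens m (1 : F^o) : htens M hunit)).
    by move=> v; apply: hrunK.
  by move=> m; rewrite /= hrun_tens scale1r.
- by move=> *; move=> v; apply: tassoc_nat.
- by move=> *; move=> v; apply: hlun_nat.
- by move=> *; move=> v; apply: hrun_nat.
- by move=> *; move=> v; apply: tassoc_pentagon.
- by move=> *; move=> v; apply: h_triangle.
Qed.
Definition hopf_monoidal : monoidal H := Monoidal hopf_monoidalP.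
End HopfRep.

Section WeakRep.
Variables (F : fieldType) (A : weak_hopf_algebra F).
Local Notation D := (comul (wh_coalg A)).
Local Notation e := (counit (wh_coalg A)).
Local Notation S := (wh_antipode A).

(* A_t *)
Definition target : lmodType F := limage (@epst F A).
Definition tgt_val : {linear target -> A} := @limval F A A (@epst F A).
Definition to_target : {linear A -> target} := @toim F A A (@epst F A).
Definition target1 : target := to_target 1.

Lemma to_targetE a : tgt_val (to_target a) = epst a. Proof. by []. Qed.
Lemma tgt_val_inj : injective tgt_val. Proof. exact: val_inj. Qed.
Lemma tgt_valP x : epst (tgt_val x) = tgt_val x.
Proof. by have [a ->] := toim_surj x; apply: epst_id. Qed.
Lemma to_targetK x : to_target (tgt_val x) = x.
Proof. by apply: tgt_val_inj; rewrite to_targetE tgt_valP. Qed.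
Lemma target1E : tgt_val target1 = 1. Proof. exact: epst1. Qed.

Fact target_findim : findim target.
Proof.
exists (size (repr (D 1))), (fun i => to_target (tnth (in_tuple (repr (D 1))) i).2).
move=> x; exists (fun i => e ((tnth (in_tuple (repr (D 1))) i).1 * tgt_val x)).
rewrite -[LHS]to_targetK -[in LHS]tgt_valP epstE linear_sum /= big_tnth.
by apply: eq_bigr => i _; rewrite linearZ.
Qed.

Definition target_act (a : A) (x : target) : target := to_target (a * tgt_val x).
Fact target_act_bilin : bilin target_act.
Proof. rewrite /target_act; linp. Qed.
Fact target_act1 x : target_act 1 x = x.
Proof. by rewrite /target_act mul1r to_targetK. Qed.
Fact target_actM a b x : target_act (a * b) x = target_act a (target_act b x).
Proof.
by apply: tgt_val_inj; rewrite /target_act !to_targetE epst_mul mulrA.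
Qed.
Definition wunit : rep A :=
  Rep target_act_bilin target_act1 target_actM target_findim.

(* M (x)^A N = Delta(1)(M (x) N); wval is its inclusion in M (x) N, wproj is
   the action of Delta(1), and wpure m n is Delta(1)(m (x) n). *)
Section Tens.
Variables M N : rep A.
Definition wtens_sort : lmodType F := limage (@tact F A M N (D 1)).
Definition wval : {linear wtens_sort -> tensor M N} := @limval F _ _ (@tact F A M N (D 1)).
Definition wproj : {linear tensor M N -> wtens_sort} := @toim F _ _ (@tact F A M N (D 1)).

Lemma wval_proj t : wval (wproj t) = tact (D 1) t. Proof. by []. Qed.
Lemma wval_inj : injective wval. Proof. exact: val_inj. Qed.

Lemma tactD a b (t : tensor M N) : tact (D a) (tact (D b) t) = tact (D (a * b)) t.
Proof. by rewrite wh_comulM tactM. Qed.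

Lemma wprojK v : wproj (wval v) = v.
Proof.
have [t ->] := toim_surj v; apply: wval_inj.
by rewrite !wval_proj tactD mulr1.
Qed.

Definition wact (a : A) (v : wtens_sort) : wtens_sort := wproj (tact (D a) (wval v)).
Lemma wactE a v : wval (wact a v) = tact (D a) (wval v).
Proof. by rewrite wval_proj tactD mul1r. Qed.
Fact wact_bilin : bilin wact.
Proof. rewrite /wact; linp. Qed.
Fact wact1 v : wact 1 v = v.
Proof. by rewrite /wact -wval_proj !wprojK. Qed.
Fact wactM a b v : wact (a * b) v = wact a (wact b v).
Proof. by apply: wval_inj; rewrite !wactE tactD. Qed.
Fact wtens_findim : findim wtens_sort.
Proof.
apply: (findim_surj (f := wproj)); [linp|exact: toim_surj|].
exact: findim_tensor (rep_findim M) (rep_findim N).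
Qed.
Definition wtens : rep A := Rep wact_bilin wact1 wactM wtens_findim.

Lemma wval_act a (v : wtens) : wval (a \act v) = tact (D a) (wval v).
Proof. exact: wactE. Qed.

Definition wpure (m : M) (n : N) : wtens := wproj (tens m n).
Lemma wpure_bilin : bilin wpure.
Proof. rewrite /wpure; linp. Qed.
Hint Resolve wpure_bilin : bil.

Lemma wval_pure m n : wval (wpure m n) = \sw_(u, v <- D 1) tens (u \act m) (v \act n).
Proof. by rewrite wval_proj tactE. Qed.

Lemma wpure1 m n : \sw_(u, v <- D 1) wpure (u \act m) (v \act n) = wpure m n.
Proof.
rewrite /wpure -(lin_tsum _ _ (g := wproj)) -?tactE; last by linp.
by apply: wval_inj; rewrite !wval_proj tactD mulr1.
Qed.

Lemma wact_pure a m n :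
  a \act wpure m n = \sw_(u, v <- D a) wpure (u \act m) (v \act n).
Proof.
rewrite /wpure -(lin_tsum _ _ (g := wproj)) -?tactE; last by linp.
by apply: wval_inj; rewrite [LHS]wactE !wval_proj !tactD mulr1 mul1r.
Qed.

Lemma wtens_ext (W : lmodType F) (f g : wtens -> W) : linear f -> linear g ->
  (forall m n, f (wpure m n) = g (wpure m n)) -> f =1 g.
Proof.
move=> lf lg fg v; rewrite -(wprojK v); move: (wval v).
apply: tens_ext; [move=> c x y|move=> c x y|exact: fg].
  by rewrite (linearP wproj) lf.
by rewrite (linearP wproj) lg.
Qed.
End Tens.
Arguments wval {M N}.
Hint Resolve wpure_bilin : bil.

Section TensHom.
Variables (M M' N N' : rep A) (f : rhom M M') (g : rhom N N').
Definition wmap (v : wtens M N) : wtens M' N' := wproj M' N' (tmap f g (wval v)).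
Fact wmap_linear : linear wmap.
Proof. rewrite /wmap; linp. Qed.
Lemma wmap_pure m n : wmap (wpure m n) = wpure (f m) (g n).
Proof.
apply: wval_inj; rewrite /wmap !wval_proj.
by rewrite tmap_tact tactD mulr1 tmap_tens.
Qed.
Fact wmap_act a v : wmap (a \act v) = a \act wmap v.
Proof.
apply: wval_inj; rewrite wval_act /wmap !wval_proj.
by rewrite !tmap_tact !tactD !(mulr1, mul1r).
Qed.
Definition wtensh : rhom (wtens M N) (wtens M' N') := mk_rhom wmap_linear wmap_act.
End TensHom.

(* The restriction of the associativity constraint of vector spaces: wproj is
   the identity on the subspaces reached here. *)
Section Assoc.
Variables M N P : rep A.
Definition wassoc_fun (v : wtens (wtens M N) P) : wtens M (wtens N P) :=
  wproj M (wtens N P)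
    (tmap idfun (wproj N P) (tassoc (tmap (@wval M N) idfun (wval v)))).
Fact wassoc_linear : linear wassoc_fun.
Proof. rewrite /wassoc_fun; linp. Qed.
Lemma wassoc_pure m n p :
  wassoc_fun (wpure (wpure m n) p) = wpure m (wpure n p).
Proof.
pose g u v w := wpure (u \act m) (wpure (v \act n) (w \act p)).
have tg : trilin g by split=> ? ? /=; rewrite /g; linp.
transitivity (\sw_(x, y <- D 1) \sw_(u, v <- D x) g u v y).
  rewrite /wassoc_fun wval_pure.
  pose h (t : tensor (wtens M N) P) : wtens M (wtens N P) := wproj M (wtens N P)
    (tmap idfun (wproj N P) (tassoc (tmap (@wval M N) idfun t))).
  have lh : linear h by rewrite /h; linp.
  rewrite -/(h _) (lin_tsum _ _ lh); apply: eq_tsum => x y.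
  rewrite /h tmap_tens wval_act wval_proj tactD mulr1 tactE.
  pose k (t : tensor M N) : wtens M (wtens N P) := wproj M (wtens N P)
    (tmap idfun (wproj N P) (tassoc (tens t (y \act p)))).
  have lk : linear k by rewrite /k; linp.
  rewrite -/(k _) (lin_tsum _ _ lk); apply: eq_tsum => u v.
  by rewrite /k tassoc_tens tmap_tens.
rewrite (swA _ tg) -[RHS]wpure1; apply: eq_tsum => x y.
by rewrite wact_pure (lin_tsum _ _ (g := wpure (x \act m))) //; linp.
Qed.
Lemma wtens_ext3 (W : lmodType F) (f g : wtens (wtens M N) P -> W) :
  linear f -> linear g ->
  (forall m n p, f (wpure (wpure m n) p) = g (wpure (wpure m n) p)) -> f =1 g.
Proof.
move=> lf lg fg; apply: wtens_ext => // v p.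
have [b _] := wpure_bilin (wtens M N) P.
move: v; apply: wtens_ext => [c x y|c x y|m n]; last exact: fg.
  by rewrite b lf.
by rewrite b lg.
Qed.
Fact wassoc_act a v : wassoc_fun (a \act v) = a \act wassoc_fun v.
Proof.
have lw := wassoc_linear.
move: v; apply: wtens_ext3; [linp|linp|] => m n p.
pose g u v w := wpure (u \act m) (wpure (v \act n) (w \act p)).
have tg : trilin g by split=> ? ? /=; rewrite /g; linp.
rewrite wassoc_pure !wact_pure (lin_tsum _ _ lw).
transitivity (\sw_(x, y <- D a) \sw_(u, v <- D x) g u v y).
  apply: eq_tsum => x y; rewrite wact_pure.
  rewrite (lin_tsum _ _ (g := fun v => wassoc_fun (wpure v (y \act p)))); last by linp.
  by apply: eq_tsum => u v; rewrite wassoc_pure.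
rewrite (swA _ tg); apply: eq_tsum => x y.
by rewrite wact_pure (lin_tsum _ _ (g := wpure (x \act m))) //; linp.
Qed.
Definition wassoc : rhom (wtens (wtens M N) P) (wtens M (wtens N P)) :=
  mk_rhom wassoc_linear wassoc_act.
End Assoc.

(* The unit constraints z (x) m |-> z m and m (x) z |-> S^-1(z) m. *)
Section Unit.
Variable M : rep A.
Definition wlun (v : wtens wunit M) : M := \sw_(z, m <- wval v) (tgt_val z \act m).
Fact wlun_linear : linear wlun.
Proof. rewrite /wlun; linp. Qed.
Hint Resolve wlun_linear : bil.
Lemma wlun_pure z m : wlun (wpure (z : wunit) m) = tgt_val z \act m.
Proof.
rewrite /wlun wval_pure.
rewrite (lin_tsum _ _ (g := fun t => \sw_(z, m <- t) (tgt_val z \act m))); last by linp.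
transitivity (\sw_(u, v <- D 1) ((epst (u * tgt_val z) * v) \act m)).
  by apply: eq_tsum => u v; rewrite tsum_tens ?ractM //; linp.
rewrite -(lin_tsum _ _ (g := fun w => w \act m)); last by linp.
by rewrite epst_act ?mul1r //; apply: tgt_valP.
Qed.
Fact wlun_act a v : wlun (a \act v) = a \act wlun v.
Proof.
have lw := wlun_linear.
move: v; apply: wtens_ext => [c x y|c x y|]; [by rewrite (ract_bilin _).2 lw|by rewrite lw (ract_bilin M).2|] => z m.
rewrite wlun_pure wact_pure (lin_tsum _ _ lw) -ractM.
transitivity (\sw_(u, v <- D a) ((epst (u * tgt_val z) * v) \act m)).
  by apply: eq_tsum => u v; rewrite wlun_pure -ractM.
rewrite -(lin_tsum _ _ (g := fun w => w \act m)); last by linp.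
by rewrite epst_act //; apply: tgt_valP.
Qed.
Definition wlunit : rhom (wtens wunit M) M := mk_rhom wlun_linear wlun_act.

Definition wrun (v : wtens M wunit) : M := \sw_(m, z <- wval v) (epsr (tgt_val z) \act m).
Fact wrun_linear : linear wrun.
Proof. rewrite /wrun; linp. Qed.
Lemma wrun_pure_act a z (m : M) :
  \sw_(u, v <- D a) (epsr (tgt_val (v \act (z : wunit))) \act (u \act m)) =
  a \act (epsr (tgt_val z) \act m).
Proof.
rewrite -ractM -epsr_act (lin_tsum _ _ (g := fun w => w \act m)); last by linp.
by apply: eq_tsum => u v; rewrite -ractM to_targetE epsr_epst.
Qed.
Lemma wrun_pure z m : wrun (wpure m (z : wunit)) = epsr (tgt_val z) \act m.
Proof.
rewrite /wrun wval_pure.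
rewrite (lin_tsum _ _ (g := fun t => \sw_(m, z <- t) (epsr (tgt_val z) \act m))); last by linp.
rewrite -[RHS]ract1 -wrun_pure_act.
by apply: eq_tsum => u v; rewrite tsum_tens //; linp.
Qed.
Fact wrun_act a v : wrun (a \act v) = a \act wrun v.
Proof.
have lw := wrun_linear.
move: v; apply: wtens_ext => [c x y|c x y|]; [by rewrite (ract_bilin _).2 lw|by rewrite lw (ract_bilin M).2|] => m z.
rewrite wrun_pure wact_pure (lin_tsum _ _ lw) -wrun_pure_act.
by apply: eq_tsum => u v; rewrite wrun_pure.
Qed.
Definition wrunit : rhom (wtens M wunit) M := mk_rhom wrun_linear wrun_act.

Lemma wlunK m : wlun (wpure (target1 : wunit) m) = m.
Proof. by rewrite wlun_pure target1E ract1. Qed.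
Lemma wrunK m : wrun (wpure m (target1 : wunit)) = m.
Proof. by rewrite wrun_pure target1E epsr1 ract1. Qed.

Lemma wpure_unitl z (m : M) : wpure (target1 : wunit) (tgt_val z \act m) = wpure (z : wunit) m.
Proof.
have ez := tgt_valP z.
pose f x y := wpure (to_target x : wunit) (y \act m).
have bf : bilin f by rewrite /f; linp.
have ee x y : f (epst x) y = f x y.
  by rewrite /f; congr wpure; apply: tgt_val_inj; rewrite !to_targetE epst_id.
transitivity (\sw_(x, y <- D (tgt_val z)) f (epst x) y).
  rewrite (sw_epst _ bf) -wpure1; apply: eq_tsum => x y.
  rewrite ee /f ractM; congr wpure; apply: tgt_val_inj.
  by rewrite !to_targetE epst1 mulr1.
under eq_tsum do rewrite ee; rewrite (swt bf ez) -[RHS]wpure1.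
by apply: eq_tsum => x y; rewrite /f; congr wpure.
Qed.

Lemma wpure_unitr (W : rep A) z (m : M) (n : W) :
  wpure (epsr (tgt_val z) \act m : M) (n : W) = wpure m (tgt_val z \act n).
Proof.
have ez := tgt_valP z.
pose f x y := wpure (x \act m) (y \act n).
have bf : bilin f by rewrite /f; linp.
rewrite -wpure1; transitivity (\sw_(u, v <- D 1) f (u * epsr (tgt_val z)) v).
  by apply: eq_tsum => u v; rewrite /f ractM.
rewrite (sw_epsr _ bf) (sw_epst_mulr bf ez) -[RHS]wpure1.
by apply: eq_tsum => u v; rewrite /f ractM.
Qed.

Lemma wpure_unitr1 z (m : M) :
  wpure (epsr (tgt_val z) \act m : M) (target1 : wunit) = wpure m (z : wunit).
Proof.
rewrite wpure_unitr; congr wpure; apply: tgt_val_inj.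
by rewrite to_targetE target1E mulr1 tgt_valP.
Qed.

Lemma wlunVK v : wpure (target1 : wunit) (wlun v) = v.
Proof.
have lw := wlun_linear.
move: v; apply: wtens_ext => [c x y|c x y|]; [by rewrite lw (wpure_bilin _ _).2|by []|] => z m.
by rewrite wlun_pure wpure_unitl.
Qed.
Lemma wrunVK v : wpure (wrun v) (target1 : wunit) = v.
Proof.
have lw := wrun_linear.
move: v; apply: wtens_ext => [c x y|c x y|]; [by rewrite lw (wpure_bilin _ _).1|by []|] => m z.
by rewrite wrun_pure wpure_unitr1.
Qed.
End Unit.

Section AssocIso.
Variables M N P : rep A.
Definition wassoc_inv (v : wtens M (wtens N P)) : wtens (wtens M N) P :=
  wproj (wtens M N) P
    (tmap (wproj M N) idfun (tassoc' (tmap idfun (@wval N P) (wval v)))).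
Fact wassoc_inv_linear : linear wassoc_inv.
Proof. 
move=> c x y; rewrite /wassoc_inv !linearP /= (tassoc'_linear c) !linearP //.
Qed.
Lemma wassoc_inv_pure m n p :
  wassoc_inv (wpure m (wpure n p)) = wpure (wpure m n) p.
Proof.
pose g u v w := wpure (wpure (u \act m) (v \act n)) (w \act p).
have tg : trilin g by split=> ? ? /=; rewrite /g; linp.
transitivity (\sw_(x, y <- D 1) \sw_(u, v <- D y) g x u v).
  rewrite /wassoc_inv wval_pure.
  pose h (t : tensor M (wtens N P)) : wtens (wtens M N) P := wproj (wtens M N) P
    (tmap (wproj M N) idfun (tassoc' (tmap idfun (@wval N P) t))).
  have lh : linear h.
    by move=> c x y; rewrite /h linearP tassoc'_linear !linearP.
  rewrite -/(h _) (lin_tsum _ _ lh); apply: eq_tsum => x y.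
  rewrite /h tmap_tens wval_act wval_proj tactD mulr1 tactE.
  pose k (t : tensor N P) : wtens (wtens M N) P := wproj (wtens M N) P
    (tmap (wproj M N) idfun (tassoc' (tens (x \act m) t))).
  have lk : linear k.
    by move=> c s t; rewrite /k (tens_bilin _ _).2 tassoc'_linear !linearP.
  rewrite -/(k _) (lin_tsum _ _ lk); apply: eq_tsum => u v.
  by rewrite /k tassoc'_tens tmap_tens.
rewrite -(swA _ tg) -[RHS]wpure1; apply: eq_tsum => x y.
by rewrite wact_pure (lin_tsum _ _ (g := fun t => wpure t (y \act p))) //; linp.
Qed.
Lemma wassocK : cancel (@wassoc_fun M N P) wassoc_inv.
Proof.
have l1 := wassoc_linear; have l2 := wassoc_inv_linear.
apply: wtens_ext3; [by move=> c x y; rewrite l1 l2|by []|] => m n p.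
by rewrite wassoc_pure wassoc_inv_pure.
Qed.
Lemma wassocVK : cancel wassoc_inv (@wassoc_fun M N P).
Proof.
have l1 := @wassoc_linear M N P; have l2 := wassoc_inv_linear.
apply: wtens_ext; [by move=> c x y; rewrite l2 l1|by []|] => m v.
have [_ b] := wpure_bilin M (wtens N P).
move: v; apply: wtens_ext; [by move=> c x y; rewrite b l2 l1|by []|] => n p.
by rewrite wassoc_inv_pure wassoc_pure.
Qed.
End AssocIso.

Definition weak_monoidal_data : monoidal_data A :=
  MonoidalData wtensh wassoc wlunit wrunit.
Fact weak_monoidalP : monoidal_axioms weak_monoidal_data.
Proof.
split.
- move=> M N; apply: wtens_ext; [exact: rhomL|exact: rhomL|] => m n.
  exact: wmap_pure.
- move=> M M' M'' N N' N'' f' f g' g.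
  apply: wtens_ext; [exact: rhomL|exact: rhomL|] => m n.
  by rewrite /= !wmap_pure.
- by move=> M N P; apply: (riso_bij (f := wassoc M N P) (@wassocK M N P) (@wassocVK M N P)).
- by move=> M; apply: (riso_bij (f := wlunit M) (@wlunVK M) (@wlunK M)).
- by move=> M; apply: (riso_bij (f := wrunit M) (@wrunVK M) (@wrunK M)).
- move=> M M' N N' P P' f g h.
  apply: wtens_ext3; [exact: rhomL|exact: rhomL|] => m n p.
  by rewrite /= wassoc_pure !wmap_pure /= !wmap_pure wassoc_pure.
- move=> M M' f; apply: wtens_ext; [exact: rhomL|exact: rhomL|] => z m.
  by rewrite /= wmap_pure !wlun_pure rhomP.
- move=> M M' f; apply: wtens_ext; [exact: rhomL|exact: rhomL|] => m z.
  by rewrite /= wmap_pure !wrun_pure rhomP.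
- move=> M N P Q.
  apply: wtens_ext3; [exact: rhomL|exact: rhomL|] => v p q.
  have [b1 _] := wpure_bilin (wtens (wtens M N) P) Q.
  have [b2 _] := wpure_bilin (wtens M N) P.
  move: v; apply: wtens_ext => [c x y|c x y|m n].
  + by rewrite b2 b1 rhomL.
  + by rewrite b2 b1 rhomL.
  by rewrite /= !wassoc_pure !wmap_pure /= !wassoc_pure wmap_pure /= wassoc_pure.
- move=> M N; apply: wtens_ext3; [exact: rhomL|exact: rhomL|] => m z n.
  by rewrite /= wassoc_pure !wmap_pure /= wlun_pure wrun_pure wpure_unitr.
Qed.
Definition weak_monoidal : monoidal A := Monoidal weak_monoidalP.
End WeakRep.
Arguments tgt_val {F A}.
Arguments wval {F A M N}.

Record hopf_map (F : fieldType) (A : weak_hopf_algebra F) (H : hopf_algebra F) :=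
  HopfMap {
  hm_fun :> {linear A -> H};
  hm_comul : forall a : A,
    comul (ha_coalg H) (hm_fun a) = tmap hm_fun hm_fun (comul (wh_coalg A) a);
  hm_counit : forall a : A,
    counit (ha_coalg H) (hm_fun a) = counit (wh_coalg A) a;
  hm_antipode : forall a : A, hm_fun (wh_antipode A a) = ha_antipode H (hm_fun a);
  hm_mull : forall a b : A,
    \sw_(x, y <- comul (wh_coalg A) 1)
      (hm_fun (a * wh_antipode A x) * hm_fun (y * b)) = hm_fun (a * b);
  hm_mulr : forall a b : A,
    \sw_(x, y <- comul (wh_coalg A) 1)
      (hm_fun (a * x) * hm_fun (wh_antipode A y * b)) = hm_fun (a * b)
}.

Section Restriction.
Variables (F : fieldType) (A : weak_hopf_algebra F) (H : hopf_algebra F).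
Variable pi : hopf_map A H.
Local Notation D := (comul (wh_coalg A)).
Local Notation S := (wh_antipode A).

Section Object.
Variable M : rep H.

(* S(1_1) (x) pi(1_2 a) m, for a in A.  The first leg of (S (x) id)(Delta 1) lies
   in A_t, on which eps_t is the identity; to_target (that is, eps_t) is applied
   to it only to obtain an element of the type of A_t: see sw_epstS1. *)
Definition res_rel (a : A) (m : M) : tensor (target A) M :=
  \sw_(x, y <- D 1) tens (to_target A (S x)) (pi (y * a) \act m).
Lemma res_rel_bilin : bilin res_rel.
Proof. rewrite /res_rel; linp. Qed.
Hint Resolve res_rel_bilin : bil.

Definition res_gen (t : tensor (target A) M) : Prop :=
  exists (x : target A) (m : M), t = tens x m - res_rel (tgt_val x) m.

Definition res_sort : lmodType F := lquot res_gen.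
Definition res_class : {linear tensor (target A) M -> res_sort} := @lclass F _ res_gen.

(* The class of x (x) m. *)
Definition box (x : target A) (m : M) : res_sort := res_class (tens x m).
Lemma box_bilin : bilin box.
Proof. rewrite /box; linp. Qed.
Hint Resolve box_bilin : bil.

Lemma box_rel x m : res_class (res_rel (tgt_val x) m) = box x m.
Proof.
symmetry; apply/lclassP/span_gen; by exists x, m.
Qed.

Lemma res_class_rel a m : res_class (res_rel a m) =
  \sw_(x, y <- D 1) box (to_target A (S x)) (pi (y * a) \act m).
Proof. by rewrite (lin_tsum _ _ (linearP res_class)). Qed.

Definition res_act_fun (a : A) (t : tensor (target A) M) : res_sort :=
  \sw_(x, m <- t) res_class (res_rel (a * tgt_val x) m).
Fact res_act_fun_linear a : linear (res_act_fun a).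
Proof. rewrite /res_act_fun; linp. Qed.
HB.instance Definition _ a :=
  GRing.isLinear.Build F _ _ _ (res_act_fun a) (res_act_fun_linear a).
Lemma res_act_fun_tens a x m :
  res_act_fun a (tens x m) = res_class (res_rel (a * tgt_val x) m).
Proof. by rewrite /res_act_fun tsum_tens; linp. Qed.
Lemma res_act_fun_rel a b m :
  res_act_fun a (res_rel b m) = res_class (res_rel (a * b) m).
Proof.
rewrite /res_rel (lin_tsum _ _ (res_act_fun_linear a)).
pose f x y := res_class (res_rel (a * x) (pi (y * b) \act m)).
have bf : bilin f by rewrite /f; linp.
transitivity (\sw_(x, y <- D 1) f (epst (S x)) y).
  by apply: eq_tsum => x y; rewrite res_act_fun_tens.
rewrite (sw_epstS1 bf) /f.
under eq_tsum do rewrite res_class_rel.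
rewrite tsum_exch res_class_rel; apply: eq_tsum => p q.
rewrite mulrA -(hm_mull pi) (lin_tsum _ _ (g := fun h : H => box _ (h \act m)));
  last by linp.
by apply: eq_tsum => x y; rewrite -mulrA ractM mulrA.
Qed.
Fact res_act_fun_gen a t : res_gen t -> res_act_fun a t = 0.
Proof.
move=> [x [m ->]]; rewrite linearB /= res_act_fun_tens res_act_fun_rel.
by rewrite subrr.
Qed.

Definition res_act (a : A) : res_sort -> res_sort := lqlift (res_act_fun a).
Fact res_act_class a t : res_act a (res_class t) = res_act_fun a t.
Proof. exact/lqliftE/res_act_fun_gen. Qed.
Lemma res_act_rel a b m :
  res_act a (res_class (res_rel b m)) = res_class (res_rel (a * b) m).
Proof. by rewrite res_act_class res_act_fun_rel. Qed.
Lemma res_act_box_rel a x m :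
  res_act a (box x m) = res_class (res_rel (a * tgt_val x) m).
Proof. by rewrite -box_rel res_act_rel. Qed.
Lemma res_act_box a x m : res_act a (box x m) =
  \sw_(u, v <- D 1) box (to_target A (S u)) (pi (v * (a * tgt_val x)) \act m).
Proof. by rewrite res_act_box_rel res_class_rel. Qed.

Lemma res_ext (W : lmodType F) (f g : res_sort -> W) : linear f -> linear g ->
  (forall x m, f (box x m) = g (box x m)) -> f =1 g.
Proof.
move=> lf lg fg v; have [t ->] := lclass_surj v.
by move: t; apply: (@tens_ext F _ _ W (f \o res_class) (g \o res_class)) => //;
  move=> c x y /=; rewrite linearP ?lf ?lg.
Qed.

Fact res_act_linear a : linear (res_act a).
Proof. exact/lqlift_linear/res_act_fun_gen. Qed.
Fact res_act_bilin : bilin res_act.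
Proof.
split; last exact: res_act_linear.
move=> v c a b /=; move: v; apply: res_ext.
- exact: res_act_linear.
- move=> k x y; rewrite !res_act_linear !scalerDr !scalerA (mulrC c).
  by rewrite addrACA.
by move=> x m; rewrite !res_act_box_rel mulrDl -scalerAl res_rel_bilin.1 linearP.
Qed.
Fact res_act1 v : res_act 1 v = v.
Proof.
move: v; apply: res_ext; [exact: res_act_linear|by []|] => x m.
by rewrite res_act_box_rel mul1r box_rel.
Qed.
Fact res_actM a b v : res_act (a * b) v = res_act a (res_act b v).
Proof.
move: v; apply: res_ext; [exact: res_act_linear| |] => [c v w|x m].
  by rewrite !res_act_linear.
by rewrite !res_act_box_rel res_act_rel mulrA.
Qed.
Fact res_findim : findim res_sort.
Proof.
apply: (findim_surj (f := res_class)); [linp|exact: lclass_surj|].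
exact: findim_tensor (@target_findim F A) (rep_findim M).
Qed.

(* The relative restriction of scalars pi^* M. *)
Definition restr : rep A := Rep res_act_bilin res_act1 res_actM res_findim.
End Object.

Section Morphism.
Variables (M N : rep H) (f : rhom M N).
Definition restr_fun0 (t : tensor (target A) M) : res_sort N :=
  res_class N (tmap idfun f t).
Fact restr_fun0_linear : linear restr_fun0.
Proof. by move=> c x y; rewrite /restr_fun0 !linearP. Qed.
HB.instance Definition _ :=
  GRing.isLinear.Build F _ _ _ restr_fun0 restr_fun0_linear.
Lemma restr_fun0_rel a m :
  restr_fun0 (res_rel a m) = res_class N (res_rel a (f m)).
Proof.
rewrite /res_rel (lin_tsum _ _ restr_fun0_linear) (lin_tsum _ _ (linearP (res_class N))).
by apply: eq_tsum => x y; rewrite /restr_fun0 tmap_tens rhomP.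
Qed.
Fact restr_fun0_gen t : res_gen t -> restr_fun0 t = 0.
Proof.
move=> [x [m ->]]; rewrite linearB /= restr_fun0_rel box_rel.
by rewrite /restr_fun0 tmap_tens subrr.
Qed.
Definition restr_fun : restr M -> restr N := lqlift restr_fun0.
Fact restr_fun_linear : linear restr_fun.
Proof. exact/lqlift_linear/restr_fun0_gen. Qed.
Lemma restr_fun_class t : restr_fun (res_class M t) = restr_fun0 t.
Proof. exact/lqliftE/restr_fun0_gen. Qed.
Lemma restr_fun_box x m : restr_fun (box x m) = box x (f m).
Proof. by rewrite restr_fun_class /restr_fun0 tmap_tens. Qed.
Fact restr_fun_act a v : restr_fun (a \act v) = a \act restr_fun v.
Proof.
move: v; apply: res_ext => [c v w|c v w|x m].
- by rewrite [_ \act _](res_act_linear a) restr_fun_linear.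
- by rewrite restr_fun_linear [LHS](res_act_linear a).
rewrite [_ \act _]res_act_box_rel restr_fun_class restr_fun0_rel restr_fun_box.
by rewrite [RHS]res_act_box_rel.
Qed.
Definition restr_hom : rhom (restr M) (restr N) :=
  mk_rhom restr_fun_linear restr_fun_act.
End Morphism.
End Restriction.

(* Main.v *)
From HB Require Import structures.
Require Import Defs.
From mathcomp Require Import all_boot all_order all_algebra.
From mathcomp Require Import boolp.
Set Implicit Arguments.
Unset Strict Implicit.
Unset Printing Implicit Defensive.
Import GRing.Theory.
Local Open Scope ring_scope.

(** Everything rests on the map [gen : m |-> 1 [box] m] from M to pi^* M.  Its
image generates pi^* M over A, since [x [box] m = x . gen m] for x in A_t, and
the defining relation of pi^* M becomes
  a . gen m = S(1_1) . gen (pi(1_2 a) m)     for all a in A.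
The relative multiplicativity pi(S(1_1)) pi(1_2 a) = pi(a) makes
[a . gen m |-> pi(a) m] a well defined linear map [restr_proj : pi^* M -> M],
and the relation above then turns into an expansion of every vector v of pi^* M ([restr_expand]):
  v = S(1_1) . gen (restr_proj (1_2 . v)).
So v is determined by the vectors restr_proj (a . v) of M, and this dependence is
natural in M.

Exactness follows at once: an equation in pi^* M can be tested, and solved, after
applying restr_proj (a . -), that is, in M.  Faithfulness is the injectivity of
[gen]: if gen m = 0 then pi(a) m = 0 for every a, and choosing a with eps(a) = 1
the antipode identity of H gives m = S(pi(a_1)) pi(a_2) m = 0.

The expansion also yields a universal property ([extend_hom]): a linear map g
from M to an A-module V extends along [gen] to a (unique) A-linear map as soon as
  a g(m) = S(1_1) g(pi(1_2 a) m).
The unitor extends c |-> c 1 from F to A_t, and the tensorator extends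
  m (x) n |-> Delta(1) (gen m (x) gen n).
Both the extension condition for the tensorator and its invertibility come from a
two-variable version of the expansion ([wpure_expand]): every Delta(1)(v (x) w) is
the sum of the S(1_1) . Delta(1)(gen (restr_proj (1_2 v)) (x)
gen (restr_proj (1_3 w))), which exhibits the inverse
  v (x) w |-> S(1_1) . gen (restr_proj (1_2 v) (x) restr_proj (1_3 w)).
Finally, an A-linear map out of pi^* M is determined by its values on [gen], where
the naturality and coherence identities are immediate. *)

(** Linearity side conditions, decided on the head symbol of the goal.  Plain
unification would compute the action on a quotient module down to a linear map
applied to a chosen representative, and then ask for the linearity of the
choice. *)
Ltac linr := repeat first
  [ exact: lin_id
  | assumption
  | match goal with |- @GRing.linear_for _ _ _ ?s ?f =>
      lazymatch f with (fun _ => _) => fail | _ => change (linear (fun z => f z)) end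
    end
  | progress (cbv beta)
  | match goal with
    | |- (_ * _)%type => split; intro
    | |- @bilinear_for _ _ _ _ _ _ _ => split; intro
    | |- @GRing.linear_for _ _ _ _ (fun z => @ract _ _ _ (@?a z) ?m) =>
      apply: (lin_bil1 _ (ract_bilin _))
    | |- @GRing.linear_for _ _ _ _ (fun z => @ract _ _ _ ?a (@?m z)) =>
      apply: (lin_bil2 _ (ract_bilin _))
    | |- @GRing.linear_for _ _ _ _ (fun z => @wpure _ _ _ _ (@?v z) ?w) =>
      apply: (lin_bil1 _ (wpure_bilin _ _))
    | |- @GRing.linear_for _ _ _ _ (fun z => @wpure _ _ _ _ ?v (@?w z)) =>
      apply: (lin_bil2 _ (wpure_bilin _ _))
    | |- @GRing.linear_for _ _ _ _ (fun z => @tsum _ _ _ _ ?t (@?f z)) =>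
      apply: tsum_linear_r; intros ? ?
    | |- @GRing.linear_for _ _ _ _ (fun z => @tsum _ _ _ _ (@?t z) ?f) => apply: lin_tsumt
    | |- @GRing.linear_for _ _ _ _ (fun z => @tens _ _ _ (@?f z) ?c) => apply: lin_tensl
    | |- @GRing.linear_for _ _ _ _ (fun z => @tens _ _ _ ?c (@?f z)) => apply: lin_tensr
    | |- @GRing.linear_for _ _ _ _ (fun z => ?g (@?v z)) =>
      apply: (lin_app (g : {linear _ -> _}))
    end
  | linp ].

(** * Identities for S(1_1) (x) 1_2 *)

Section Relative.
Variables (F : fieldType) (A : weak_hopf_algebra F) (H : hopf_algebra F).
Variable pi : hopf_map A H.
Local Notation D := (comul (wh_coalg A)).
Local Notation e := (counit (wh_coalg A)).
Local Notation S := (wh_antipode A).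

(** By the counit law, 1 is a combination of second legs of Delta(1) with
coefficients among the values of the counit; these cannot all vanish. *)
Lemma exists_counit1 : exists a : A, e a = 1 :> F.
Proof.
suff [a ea] : exists a : A, e a != 0.
  by exists ((e a : F)^-1 *: a); rewrite linearZ /= [_ *: _]mulVf.
apply: contrapT => e0; have /eqP[] := oner_neq0 A.
rewrite -(counitl (wh_coalg A) 1); apply: big1 => p _.
suff /eqP -> : e p.1 == 0 :> F by rewrite scale0r.
by apply: contrapT => /negP ep; apply: e0; exists p.1.
Qed.

(** On the first leg of Delta(1), S agrees with eps_t, and eps_t (x) id takes the
same value on Delta(1)(1 (x) a) and on Delta(a); then the counit law applies. *)
Lemma sw_S1_counit a : \sw_(x, y <- D 1) ((e (y * a) : F) *: S x) = epst a.
Proof.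
rewrite (sw_S1 (f := fun u v => (e (v * a) : F) *: u)); last by linr.
rewrite -(sw_epst (f := fun u v => (e v : F) *: u)); last by linr.
exact: swer (linearP (@epst F A)).
Qed.

(** S and eps_t agree on the first leg of Delta(1), and [epsr] inverts them: the
sum of 1'_1 (x) 1'_2 1_1 (x) 1_2 is (Delta (x) id)(Delta(1)), from whose middle
leg the counit recovers Delta(1). *)
Lemma sw_epsrS1 (W : lmodType F) (f : A -> A -> W) : bilin f ->
  \sw_(x, y <- D 1) f (epsr (S x)) y = \sw_(x, y <- D 1) f x y.
Proof.
move=> bf; have [f1 f2] := bf.
rewrite (sw_S1 (f := fun u v => f (epsr u) v)); last by linr.
have tf : trilin (fun u v w => (e v : F) *: f u w) by split=> ? ? /=; linr.
transitivity (\sw_(x, y <- D 1) \sw_(u, v <- D 1) ((e (v * x) : F) *: f u y)).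
  apply: eq_tsum => x y; rewrite epsr_epst {1}/epsr (lin_tsum _ _ (f1 y)).
  by apply: eq_tsum => u v; rewrite (linZ (f1 y)).
rewrite tsum_exch -(sw1 tf); apply: eq_tsum => x y.
exact: swer (f1 y).
Qed.

(** Because Delta(a) = Delta(1)(a (x) 1) for a in A_t. *)
Lemma target_act_wpure (V W : rep A) a (v : V) (w : W) : epst a = a ->
  a \act wpure v w = wpure (a \act v) w.
Proof.
move=> ea; rewrite wact_pure.
have bw := wpure_bilin V W.
rewrite (swt (f := fun x y => wpure (x \act v) (y \act w))) //; last by linr.
by rewrite -[RHS]wpure1; apply: eq_tsum => x y; rewrite ractM.
Qed.

(** * The relative restriction as a module generated by M *)

Section Object.
Variable M : rep H.

Definition gen (m : M) : restr pi M := box pi (target1 A) m.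
Lemma gen_linear : linear gen.
Proof. exact: (box_bilin pi M).2. Qed.
HB.instance Definition _ :=
  GRing.isLinear.Build F M (restr pi M) _ gen gen_linear.

Lemma box_gen x m : box pi x m = tgt_val x \act gen m.
Proof. by rewrite [RHS]res_act_box_rel target1E mulr1 box_rel. Qed.

(** Both sides are classes of the relator of a, the first leg S(1_1) lying in
A_t. *)
Lemma act_gen a m :
  a \act gen m = \sw_(x, y <- D 1) (S x \act gen (pi (y * a) \act m)).
Proof.
rewrite [LHS]res_act_box_rel target1E mulr1 res_class_rel.
rewrite -(sw_epstS1 (f := fun u v => u \act gen (pi (v * a) \act m))); last by linr.
by apply: eq_tsum => x y; rewrite box_gen.
Qed.

Lemma gen_ext (V : lmodType F) (f g : restr pi M -> V) : linear f -> linear g ->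
  (forall a m, f (a \act gen m) = g (a \act gen m)) -> f =1 g.
Proof.
by move=> lf lg fg; apply: res_ext => // x m; rewrite box_gen.
Qed.

Lemma rhom_gen_ext (V : rep A) (f g : rhom (restr pi M) V) :
  (forall m, f (gen m) = g (gen m)) -> f =1 g.
Proof.
move=> fg; apply: gen_ext => [||a m]; [exact: rhomL|exact: rhomL|].
by rewrite !rhomP fg.
Qed.

Definition restr_proj0 (t : tensor (target A) M) : M :=
  \sw_(x, m <- t) (pi (tgt_val x) \act m).
Fact restr_proj0_linear : linear restr_proj0. Proof. rewrite /restr_proj0; linr. Qed.
HB.instance Definition _ :=
  GRing.isLinear.Build F _ _ _ restr_proj0 restr_proj0_linear.
(** The left-hand relative multiplicativity pi(S(1_1)) pi(1_2 a) = pi(a): the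
reason why [restr_proj] descends to the quotient. *)
Lemma restr_proj0_rel a m : restr_proj0 (res_rel pi a m) = pi a \act m.
Proof.
rewrite /res_rel (lin_tsum _ _ restr_proj0_linear).
transitivity (\sw_(x, y <- D 1) (pi (epst (S x)) \act (pi (y * a) \act m))).
  by apply: eq_tsum => x y; rewrite /restr_proj0 tsum_tens //; linr.
rewrite (sw_epstS1 (f := fun u v => pi u \act (pi (v * a) \act m))); last by linr.
rewrite -[X in _ = pi X \act _]mul1r -(hm_mull pi).
rewrite (lin_tsum _ _ (g := fun h : H => h \act m)); last by linr.
by apply: eq_tsum => x y; rewrite ractM mul1r.
Qed.
Fact restr_proj0_gen t : res_gen pi t -> restr_proj0 t = 0.
Proof.
move=> [x [m ->]]; rewrite linearB /= restr_proj0_rel.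
by rewrite /restr_proj0 tsum_tens ?subrr //; linr.
Qed.

Definition restr_proj : restr pi M -> M := lqlift restr_proj0.
Lemma restr_proj_linear : linear restr_proj.
Proof. exact/lqlift_linear/restr_proj0_gen. Qed.
HB.instance Definition _ :=
  GRing.isLinear.Build F (restr pi M) M _ restr_proj restr_proj_linear.

Lemma restr_proj_act_gen a m : restr_proj (a \act gen m) = pi a \act m.
Proof.
rewrite [a \act _]res_act_box_rel target1E mulr1.
rewrite -(restr_proj0_rel a m); exact: (lqliftE restr_proj0_gen).
Qed.

(** [act_gen] with its pi(1_2 a) m rewritten through [restr_proj], so that it no
longer mentions how the vector is generated. *)
Lemma restr_expand v :
  \sw_(x, y <- D 1) (S x \act gen (restr_proj (y \act v))) = v.
Proof.
move: v; apply: gen_ext => [||a m]; [linr|linr|].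
rewrite [RHS]act_gen; apply: eq_tsum => x y.
by rewrite -ractM restr_proj_act_gen.
Qed.

(** With eps(a) = 1, the map v |-> S(pi(a_1)) restr_proj (a_2 . v) is a retraction
of [gen], by the antipode axiom at pi(a).  The choice a = 1 does not
serve here, as eps(1) may vanish. *)
Lemma gen_inj : injective gen.
Proof.
have [a ea] := exists_counit1.
suff genK m : \sw_(x, y <- D a) (pi (S x) \act restr_proj (y \act gen m)) = m.
  by move=> m n mn; rewrite -[m]genK mn genK.
transitivity ((\sw_(x, y <- comul (ha_coalg H) (pi a)) (ha_antipode H x * y)) \act m).
  rewrite hm_comul /tmap.
  rewrite (lin_tsum _ _ (g := fun z => (\sw_(x, y <- z) (ha_antipode H x * y)) \act m));
    last by linr.
  apply: eq_tsum => x y; rewrite tsum_tens; last by linr.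
  by rewrite restr_proj_act_gen ractM hm_antipode.
by rewrite ha_antipodel hm_counit ea scale1r ract1.
Qed.

(** ** Extending linear maps along [gen] *)

Section Extension.
Variables (V : rep A) (g : {linear M -> V}).
Hypothesis gP : forall a m,
  a \act g m = \sw_(x, y <- D 1) (S x \act g (pi (y * a) \act m)).

Definition extend (v : restr pi M) : V :=
  \sw_(x, y <- D 1) (S x \act g (restr_proj (y \act v))).
Fact extend_linear : linear extend. Proof. rewrite /extend; linr. Qed.
HB.instance Definition _ :=
  GRing.isLinear.Build F (restr pi M) V _ extend extend_linear.
Lemma extend_act_gen a m : extend (a \act gen m) = a \act g m.
Proof.
by rewrite gP; apply: eq_tsum => x y; rewrite -ractM restr_proj_act_gen.
Qed.
Fact extend_act a v : extend (a \act v) = a \act extend v.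
Proof.
move: v; apply: gen_ext => [||b m]; [linr|linr|].
by rewrite -ractM !extend_act_gen ractM.
Qed.
Definition extend_hom : rhom (restr pi M) V := mk_rhom extend_linear extend_act.
Lemma extend_gen m : extend (gen m) = g m.
Proof. by rewrite -[gen m]ract1 extend_act_gen ract1. Qed.
Lemma extend_box x m : extend (box pi x m) = tgt_val x \act g m.
Proof. by rewrite box_gen extend_act_gen. Qed.
End Extension.
End Object.

(** * Exactness *)

Lemma restr_hom_gen (M N : rep H) (f : rhom M N) m :
  restr_hom pi f (gen m) = gen (f m).
Proof. exact: restr_fun_box. Qed.

Lemma restr_proj_nat (M N : rep H) (f : rhom M N) v :
  restr_proj (restr_hom pi f v) = f (restr_proj v).
Proof.
move: v; apply: gen_ext => [||a m].
- by move=> c x y; rewrite rhomL restr_proj_linear.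
- by move=> c x y; rewrite restr_proj_linear rhomL.
by rewrite rhomP restr_hom_gen !restr_proj_act_gen rhomP.
Qed.

(** By [restr_expand] and the naturality of [restr_proj], preimages in pi^* M are
assembled from preimages in M; these may be chosen arbitrarily, since only the
values of the maps on them enter. *)
Lemma restr_exact (M N P : rep H) (f : rhom M N) (g : rhom N P) :
  short_exact f g -> short_exact (restr_hom pi f) (restr_hom pi g).
Proof.
move=> [fI fg gS]; split.
- move=> v w vw; rewrite -[v]restr_expand -[w]restr_expand.
  apply: eq_tsum => x y; congr (_ \act gen _); apply: fI.
  by rewrite -!restr_proj_nat !rhomP vw.
- move=> n; split=> [gn|[v ->]].
    have /choice[h hP] a : exists m, restr_proj (a \act n) = f m.
      by apply/fg; rewrite -restr_proj_nat rhomP gn (lin0 ((ract_bilin _).2 _))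
        (lin0 (@restr_proj_linear P)).
    exists (\sw_(x, y <- D 1) (S x \act gen (h y))).
    rewrite (lin_tsum _ _ (rhomL (restr_hom pi f))) -[LHS]restr_expand.
    by apply: eq_tsum => x y; rewrite rhomP restr_hom_gen hP.
  rewrite -[RHS]restr_expand -[LHS]restr_expand; apply: eq_tsum => x y.
  rewrite -!rhomP !restr_proj_nat (lin0 ((ract_bilin _).2 _)) (lin0 (@restr_proj_linear P)).
  by congr (_ \act gen _); apply/fg; exists (restr_proj (y \act v)).
- move=> p; have /choice[h hP] := gS.
  exists (\sw_(x, y <- D 1) (S x \act gen (h (restr_proj (y \act p))))).
  rewrite (lin_tsum _ _ (rhomL (restr_hom pi g))) -[LHS]restr_expand.
  by apply: eq_tsum => x y; rewrite rhomP restr_hom_gen -hP.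
Qed.

(** * The tensorator *)

(** Expand w; the factors S(1_1) of A_t acting on w move across the tensor product
over A_t and become S^-1(S(1_1)) = 1_1 acting on v. *)
Lemma wpure_expandr (V : rep A) (N : rep H) (v : V) (w : restr pi N) :
  \sw_(x, y <- D 1) wpure (x \act v) (gen (restr_proj (y \act w))) = wpure v w.
Proof.
have bw := wpure_bilin V (restr pi N).
rewrite -[in RHS](restr_expand w) (lin_tsum _ _ (bw.2 v)).
rewrite -(sw_epsrS1 (f := fun x y => wpure (x \act v) (gen (restr_proj (y \act w)))));
  last by linr.
(* Now S(1_1) stands on both sides, and eps_t shows it as an element of A_t. *)
rewrite -(sw_epstS1 (f := fun x y => wpure (epsr x \act v) (gen (restr_proj (y \act w)))));
  last by linr.
rewrite -(sw_epstS1 (f := fun x y => wpure v (x \act gen (restr_proj (y \act w)))));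
  last by linr.
by apply: eq_tsum => x y; rewrite -!to_targetE wpure_unitr.
Qed.

Section Tensorator.
Variables M N : rep H.

(** Since (id (x) Delta)(Delta(1)) is the sum of the 1_1 (x) 1_2 1'_1 (x) 1'_2,
expanding w by [wpure_expandr] leaves 1'_1 acting on v,
and expanding 1'_1 . v by [restr_expand] gives the three legs; S(1_1), being in
A_t, acts on the first factor alone. *)
Lemma wpure_expand (v : restr pi M) (w : restr pi N) :
  \sw_(x, y <- D 1) \sw_(y1, y2 <- D y)
    (S x \act wpure (gen (restr_proj (y1 \act v))) (gen (restr_proj (y2 \act w)))) =
  wpure v w.
Proof.
pose f x y z := x \act wpure (gen (restr_proj (y \act v))) (gen (restr_proj (z \act w))).
have tf : trilin f by split=> ? ? /=; rewrite /f; linr.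
have [f1 f2 f3] := tf.
rewrite -/f.
have tg : trilin (fun x y z => f (S x) y z) by split=> ? ? /=; linr.
rewrite -(swA _ tg) (sw1 tg) tsum_exch -[RHS]wpure_expandr.
apply: eq_tsum => u z.
rewrite -[in RHS](restr_expand (u \act v)).
rewrite (lin_tsum _ _ (g := fun t => wpure t _)); last by linr.
(* Both sums are rewritten with eps_t (S(1_1)) for S(1_1), to see it in A_t. *)
rewrite -(sw_epstS1 (f := fun x y => f x (y * u) z)); last by linr.
rewrite -(sw_epstS1 (f := fun x y => wpure (x \act gen (restr_proj (y \act (u \act v))))
   (gen (restr_proj (z \act w))))); last by linr.
apply: eq_tsum => x y.
by rewrite /f target_act_wpure ?epst_id // ractM.
Qed.

Definition wpure_gen (t : htens M N) : wtens (restr pi M) (restr pi N) :=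
  \sw_(m, n <- t) wpure (gen m) (gen n).
Fact wpure_gen_linear : linear wpure_gen.
Proof.
apply: tsum_linear; linr.
Qed.
HB.instance Definition _ := GRing.isLinear.Build F (htens M N)
  (wtens (restr pi M) (restr pi N)) _ wpure_gen wpure_gen_linear.
Lemma wpure_gen_tens m n : wpure_gen (tens m n) = wpure (gen m) (gen n).
Proof.
by apply: tsum_tens; linr.
Qed.

Lemma hm_act_tens a (m : M) (n : N) :
  pi a \act (tens m n : htens M N) =
  \sw_(x, y <- D a) tens (pi x \act m) (pi y \act n).
Proof.
rewrite [LHS]tactE hm_comul /tmap.
rewrite (lin_tsum _ _ (g := fun z => \sw_(x, y <- z) tens (x \act m) (y \act n)));
  last by linr.
by apply: eq_tsum => x y; rewrite tsum_tens //; linr.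
Qed.

(** The extension condition, obtained from [wpure_expand] at v = a_1 . gen m and
w = a_2 . gen n, where [restr_proj] returns pi(1_2 a_1) m and pi(1_3 a_2) n. *)
Lemma wpure_genP a (t : htens M N) : a \act wpure_gen t =
  \sw_(x, y <- D 1) (S x \act wpure_gen (pi (y * a) \act t)).
Proof.
move: t; apply: tens_ext; [linr|linr|] => m n.
rewrite wpure_gen_tens wact_pure.
transitivity (\sw_(u, v <- D a) \sw_(x, y <- D 1) \sw_(y1, y2 <- D y) (S x \act
   wpure (gen (restr_proj (y1 \act (u \act gen m))))
     (gen (restr_proj (y2 \act (v \act gen n)))))).
  by apply: eq_tsum => u v; rewrite wpure_expand.
rewrite tsum_exch; apply: eq_tsum => x y.
rewrite hm_act_tens (lin_tsum _ _ wpure_gen_linear) (lin_tsum _ _ ((ract_bilin _).2 _)).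
rewrite [RHS](swM (f := fun u v => S x \act wpure_gen (tens (pi u \act m) (pi v \act n))));
  last by linr.
rewrite tsum_exch; apply: eq_tsum => u v; apply: eq_tsum => y1 y2.
by rewrite wpure_gen_tens -!ractM !restr_proj_act_gen.
Qed.

Definition tensorator :
    rhom (restr pi (htens M N)) (wtens (restr pi M) (restr pi N)) :=
  extend_hom wpure_genP.

Lemma tensorator_gen m n :
  tensorator (gen (tens m n : htens M N)) = wpure (gen m) (gen n).
Proof. exact: etrans (extend_gen wpure_genP _) (wpure_gen_tens m n). Qed.

Definition tensorator_inv_pure (v : restr pi M) (w : restr pi N) :
    restr pi (htens M N) :=
  \sw_(x, y <- D 1) \sw_(y1, y2 <- D y)
    (S x \act gen (tens (restr_proj (y1 \act v)) (restr_proj (y2 \act w)) : htens M N)).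
Fact tensorator_inv_pure_bilin : bilin tensorator_inv_pure.
Proof. rewrite /tensorator_inv_pure; linr. Qed.

Definition tensorator_inv (t : wtens (restr pi M) (restr pi N)) :
    restr pi (htens M N) :=
  \sw_(v, w <- wval t) tensorator_inv_pure v w.
Fact tensorator_inv_linear : linear tensorator_inv.
Proof.
have bi := tensorator_inv_pure_bilin.
move=> c x y; rewrite /tensorator_inv linearP; exact: tsum_linear.
Qed.

(** Delta(1_2) absorbs Delta(1), so the formula for the inverse may be applied to
v (x) w in place of its projection Delta(1)(v (x) w). *)
Lemma tensorator_inv_wpure v w :
  tensorator_inv (wpure v w) = tensorator_inv_pure v w.
Proof.
have bi := tensorator_inv_pure_bilin.
rewrite /tensorator_inv wval_pure.
rewrite (lin_tsum _ _ (tsum_linear bi)).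
transitivity (\sw_(u, u' <- D 1) tensorator_inv_pure (u \act v) (u' \act w)).
  by apply: eq_tsum => u u'; rewrite tsum_tens.
rewrite /tensorator_inv_pure tsum_exch; apply: eq_tsum => x y.
rewrite tsum_exch -[RHS]sw1r; last by linr.
by apply: eq_tsum => y1 y2; apply: eq_tsum => u u'; rewrite !ractM.
Qed.

(** The computation of [wpure_genP] with Delta(1)(gen m (x) gen n) replaced by
gen (m (x) n), ending at [act_gen] for the latter. *)
Lemma tensorator_inv_act a m n :
  tensorator_inv (a \act wpure (gen m) (gen n)) =
  a \act gen (tens m n : htens M N).
Proof.
rewrite wact_pure (lin_tsum _ _ tensorator_inv_linear) [RHS]act_gen.
transitivity (\sw_(u, v <- D a)
    tensorator_inv_pure (u \act gen m) (v \act gen n)).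
  by apply: eq_tsum => u v; rewrite tensorator_inv_wpure.
rewrite /tensorator_inv_pure tsum_exch; apply: eq_tsum => x y.
rewrite hm_act_tens (lin_tsum _ _ (@gen_linear (htens M N))).
rewrite (lin_tsum _ _ ((ract_bilin _).2 _)).
rewrite [RHS](swM (f := fun u v => S x \act
    gen (tens (pi u \act m) (pi v \act n) : htens M N)));
  last by linr.
rewrite tsum_exch; apply: eq_tsum => y1 y2; apply: eq_tsum => u v.
by rewrite -!ractM !restr_proj_act_gen.
Qed.

(** One composite is checked on the a . gen (m (x) n), by A-linearity of the
tensorator; the other one is the expansion [wpure_expand]. *)
Lemma tensorator_iso : riso tensorator.
Proof.
have li := tensorator_inv_linear.
apply: (riso_bij (g := tensorator_inv)).
- apply: gen_ext => [c u v||a]; [by rewrite rhomL li|by []|].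
  apply: tens_ext => [c s t|c s t|m n].
  + by rewrite linearP (ract_bilin _).2 rhomL li.
  + by rewrite linearP (ract_bilin _).2.
  by rewrite rhomP tensorator_gen tensorator_inv_act.
- apply: wtens_ext => [c u v||v w]; [by rewrite li rhomL|by []|].
  rewrite tensorator_inv_wpure (lin_tsum _ _ (rhomL tensorator)) -[RHS]wpure_expand.
  apply: eq_tsum => x y; rewrite (lin_tsum _ _ (rhomL tensorator)).
  by apply: eq_tsum => y1 y2; rewrite rhomP tensorator_gen.
Qed.
End Tensorator.

(** * The unitor *)

Section Unitor.
Definition unit_gen (c : hunit H) : wunit A := (c : F) *: target1 A.
Fact unit_gen_linear : linear unit_gen.
Proof. by move=> k c d; rewrite /unit_gen scalerDl scalerA. Qed.
HB.instance Definition _ :=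
  GRing.isLinear.Build F (hunit H) (wunit A) _ unit_gen unit_gen_linear.

(** Both sides are c eps_t(a), because pi is counital. *)
Lemma unit_genP a (c : hunit H) : a \act unit_gen c =
  \sw_(x, y <- D 1) (S x \act unit_gen (pi (y * a) \act c)).
Proof.
have act1 b : b \act (target1 A : wunit A) = to_target A b.
  by change (target_act b (target1 A) = to_target A b); rewrite /target_act target1E mulr1.
rewrite /unit_gen (linZ ((ract_bilin _).2 _)) act1.
transitivity ((c : F) *: to_target A (\sw_(x, y <- D 1) ((e (y * a) : F) *: S x))).
  by rewrite sw_S1_counit; congr (_ *: _); apply: tgt_val_inj; rewrite !to_targetE epst_id.
rewrite (lin_tsum _ _ (linearP (to_target A))) -tsumZ; apply: eq_tsum => x y.
by rewrite (linZ ((ract_bilin _).2 _)) act1 linearZ scalerA mulrC /= -(hm_counit pi).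
Qed.

Definition unitor : rhom (restr pi (hunit H)) (wunit A) := extend_hom unit_genP.
Lemma unitor_box x : unitor (box pi x (1 : hunit H)) = x.
Proof.
rewrite [LHS](extend_box unit_genP).
change (target_act (tgt_val x) ((1 : F) *: target1 A) = x).
by rewrite scale1r /target_act target1E mulr1 to_targetK.
Qed.
Lemma unitor_gen (c : hunit H) : unitor (gen c) = (c : F) *: target1 A.
Proof. exact: extend_gen unit_genP c. Qed.

Lemma unitor_iso : riso unitor.
Proof.
apply: (@riso_bij _ _ _ _ unitor (fun x => box pi x (1 : hunit H))) => [|x];
  last exact: unitor_box.
have bb := box_bilin pi (hunit H).
apply: res_ext => [k u v||x c]; [by rewrite rhomL bb.1|by []|].
have -> : c = (c : F) *: (1 : hunit H) by rewrite [RHS]mulr1.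
by rewrite (linZ (bb.2 _)) linearZ unitor_box (linZ (bb.1 _)).
Qed.
End Unitor.

(** * Naturality and coherence *)

Lemma rcompE (M N P : rep A) (g : rhom N P) (f : rhom M N) m :
  rcomp g f m = g (f m).
Proof. by []. Qed.
Lemma wtenshE (M M' N N' : rep A) (f : rhom M M') (g : rhom N N') m n :
  wtensh f g (wpure m n) = wpure (f m) (g n).
Proof. exact: wmap_pure. Qed.
Lemma wassocE (M N P : rep A) (m : M) (n : N) (p : P) :
  wassoc M N P (wpure (wpure m n) p) = wpure m (wpure n p).
Proof. exact: wassoc_pure. Qed.

Lemma rhom_gen_tens_ext (M N : rep H) (V : rep A)
    (f g : rhom (restr pi (htens M N)) V) :
  (forall m n, f (gen (tens m n : htens M N)) = g (gen (tens m n : htens M N))) ->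
  f =1 g.
Proof.
move=> fg; apply: rhom_gen_ext; apply: tens_ext => // c s t.
  by rewrite (gen_linear c) rhomL.
by rewrite (gen_linear c) rhomL.
Qed.

Lemma tensorator_nat (M M' N N' : rep H) (f : rhom M M') (g : rhom N N') :
  rcomp (tensorator M' N') (restr_hom pi (htensh f g)) =1
  rcomp (wtensh (restr_hom pi f) (restr_hom pi g)) (tensorator M N).
Proof.
apply: rhom_gen_tens_ext => m n.
rewrite !rcompE tensorator_gen wtenshE !restr_hom_gen -tensorator_gen.
congr (tensorator _ _ (gen _)); exact: tmap_tens.
Qed.

Lemma tensorator_assoc (M N P : rep H) :
  rcomp (wassoc (restr pi M) (restr pi N) (restr pi P))
    (rcomp (wtensh (tensorator M N) (rid (restr pi P))) (tensorator (htens M N) P)) =1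
  rcomp (wtensh (rid (restr pi M)) (tensorator N P))
    (rcomp (tensorator M (htens N P)) (restr_hom pi (hassoc M N P))).
Proof.
apply: rhom_gen_tens_ext => t p; move: t.
apply: tens_ext => [c s t|c s t|m n].
- by rewrite (tens_bilin _ _).1 (gen_linear c) rhomL.
- by rewrite (tens_bilin _ _).1 (gen_linear c) rhomL.
rewrite !rcompE restr_hom_gen tensorator_gen wtenshE tensorator_gen wassocE.
have -> : hassoc M N P (tens (tens m n) p) = tens m (tens n p) by exact: tassoc_tens.
by rewrite tensorator_gen wtenshE tensorator_gen.
Qed.

Lemma tensorator_lunit (M : rep H) :
  rcomp (wlunit (restr pi M))
    (rcomp (wtensh unitor (rid (restr pi M))) (tensorator (hunit H) M)) =1
  restr_hom pi (hlunit M).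
Proof.
apply: rhom_gen_tens_ext => c m.
rewrite !rcompE restr_hom_gen tensorator_gen wtenshE unitor_gen.
have -> : hlunit M (tens c m) = (c : F) *: m by exact: hlun_tens.
have -> : wlunit (restr pi M) (wpure ((c : F) *: target1 A : wunit A) (gen m)) = c *: gen m.
  rewrite (linZ ((wpure_bilin _ _).1 _)) linearZ; congr (_ *: _); exact: wlunK.
by rewrite (linZ (@gen_linear M)).
Qed.

Lemma tensorator_runit (M : rep H) :
  rcomp (wrunit (restr pi M))
    (rcomp (wtensh (rid (restr pi M)) unitor) (tensorator M (hunit H))) =1
  restr_hom pi (hrunit M).
Proof.
apply: rhom_gen_tens_ext => m c.
rewrite !rcompE restr_hom_gen tensorator_gen wtenshE unitor_gen.
have -> : hrunit M (tens m c) = (c : F) *: m by exact: hrun_tens.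
have -> : wrunit (restr pi M) (wpure (gen m) ((c : F) *: target1 A : wunit A)) = c *: gen m.
  rewrite (linZ ((wpure_bilin _ _).2 _)) linearZ; congr (_ *: _); exact: wrunK.
by rewrite (linZ (@gen_linear M)).
Qed.

End Relative.

Theorem theorem3p3 (F : fieldType) (A : weak_hopf_algebra F)
    (H : hopf_algebra F) (pi : hopf_map A H) :
  exists (phi0 : rhom (restr pi (munit (hopf_monoidal H)))
                      (munit (weak_monoidal A)))
         (phi2 : forall M N : rep H,
            rhom (restr pi (mtens (hopf_monoidal H) M N))
                 (mtens (weak_monoidal A) (restr pi M) (restr pi N))),
    [/\ forall x : target A, phi0 (@box F A H pi (hunit H) x (1 : F)) = x,
        forall (M N : rep H) (x : target A) (m : M) (n : N),
          wval (phi2 M N (@box F A H pi (htens M N) x (tens m n))) =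
          \sw_(u, v <- comul (wh_coalg A) 1)
            tens (u \act (box pi x m : restr pi M))
                 (v \act (box pi (target1 A) n : restr pi N))
      & tensor_functor (@restr_hom F A H pi) phi0 phi2].
Proof.
exists (unitor pi), (tensorator pi); split.
- exact: unitor_box.
- move=> M N x m n; rewrite box_gen rhomP [X in _ \act X]tensorator_gen.
  by rewrite target_act_wpure ?tgt_valP // wval_pure -box_gen.
split.
- by move=> M; apply: rhom_gen_ext => m; rewrite restr_hom_gen.
- move=> M N P g f; apply: rhom_gen_ext => m.
  by rewrite rcompE !restr_hom_gen.
- move=> M N c f g; apply: rhom_gen_ext => m.
  rewrite restr_hom_gen -[RHS]/(c *: restr_hom pi f (gen pi m) + restr_hom pi g (gen pi m)).
  by rewrite !restr_hom_gen -(gen_linear pi c).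
- move=> M N f g fg m; apply: (@gen_inj _ _ _ pi).
  by rewrite -!restr_hom_gen fg.
- by move=> M N P f g; apply: restr_exact.
- exact: unitor_iso.
- by move=> M N; apply: tensorator_iso.
- exact: tensorator_nat.
- exact: tensorator_assoc.
- exact: tensorator_lunit.
- exact: tensorator_runit.
Qed.
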